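(* For every $\varepsilon>0$ there exists $N_0$ such that the following holds. Let $N>N_0$ be an integer, let $\mathcal{S}$ be a finite set with $1\le \log_2|\mathcal{S}|< N/12$, and let $G:\mathcal{S}\to\{-1,1\}^N$, $s\mapsto E_N(s)=(e_1(s),\dots,e_N(s))$, be a random map for which the $e_n(s)$ ($s\in\mathcal{S}$, $1\le n\le N$) are chosen from $\{-1,1\}$ uniformly and independently. Then, with probability at least $1-\varepsilon$, we have $$\frac{2}{5} \sqrt{N\left(\log \binom{N}{k}+k\log|\mathcal{S}|\right)} <\widetilde{\Phi}_k (G) < \frac{5}{2}\sqrt{N\left(\log \binom{N}{k}+k\log|\mathcal{S}|\right)}$$ for every integer $k$ with $2\leq k \leq N/(6\log_2|\mathcal{S}|)$ (simultaneously).
   Context: $\log$ denotes the natural logarithm and $\log_2$ the logarithm to base 2. Definition of the cross-correlation measure $\widetilde{\Phi}_k(G)$ of order $k$ ($k\ge 2$) of a binary sequence generator, i.e. of a map $G:\mathcal{S}\to\{-1,1\}^N$, $s\mapsto E_N(s)=(e_1(s),\dots,e_N(s))$. Let $M,k_1,\dots,k_\ell\ge 1$ be integers with $k=k_1+k_2+\dots+k_\ell$, and let $D=(d_1^1,\dots,d_{k_1}^1,d_1^2,\dots,d_{k_2}^2,\dots,d_1^\ell,\dots,d_{k_\ell}^\ell)$ be a $k$-tuple of integers such that $$0\leq d_1^i< d_2^i< \dots< d_{k_i}^i<M+d_{k_i}^i\leq N\quad\text{for } i=1,\dots,\ell.$$ For distinct $s_1,\dots,s_\ell\in\mathcal{S}$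 write $$V_{k_1,\dots,k_\ell}\left(E_N(s_1),\dots,E_N(s_\ell),M,D\right)=\sum_{n=1}^{M}\ \prod_{i=1}^{\ell}\ \prod_{j=1}^{k_i} e_{n+d_j^i}(s_i).$$ Then $$\widetilde{\Phi}_k(G)=\max \left| V_{k_1,\dots,k_\ell}\left(E_N(s_1),\dots,E_N(s_\ell),M,D\right)\right|,$$ where the maximum is over all $\ell\ge1$, all integers $k_1,\dots,k_\ell\ge1$ with $k_1+\dots+k_\ell=k$, all distinct $s_1,\dots,s_\ell\in\mathcal{S}$, and all integers $M\ge1$ and $k$-tuples of integers $D=(d_1^1,\dots,d_{k_1}^1,\dots,d_1^\ell,\dots,d_{k_\ell}^\ell)$ satisfying $0\leq d_1^i< d_2^i< \dots< d_{k_i}^i<M+d_{k_i}^i\leq N$ for $i=1,\dots,\ell$. *)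

(* Defs.v *)
From HB Require Import structures.
From mathcomp Require Import all_boot all_order all_algebra.
From mathcomp Require Import all_classical all_reals all_analysis.

Set Implicit Arguments.
Unset Strict Implicit.
Unset Printing Implicit Defensive.

Import Order.TTheory GRing.Theory Num.Theory.

Local Open Scope classical_set_scope.
Local Open Scope ring_scope.

Definition log2 {R : realType} (x : R) : R := ln x / ln 2.

(* The terms of a sequence are numbered from 1: e_1, ..., e_N. *)
Definition term {R : realType} {N : nat} (E : N.-tuple R) (n : nat) : R :=
  E`_n.-1.

(* The conditions 0 <= d_1^i < ... < d_(k_i)^i < M + d_(k_i)^i <= N, where D i
   is the block (d_1^i, ..., d_(k_i)^i). The lower bound 0 <= d_1^i is carried
   by the type nat; [last] is only used on nonempty blocks. *)
Definition admissible (N l : nat) (ks : 'I_l -> nat) (M : nat)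
    (D : forall i : 'I_l, (ks i).-tuple nat) : Prop :=
  forall i : 'I_l,
    [/\ sorted ltn (D i),
        (last 0 (D i) < M + last 0 (D i))%N
      & (M + last 0 (D i) <= N)%N].

Definition cross_sum {R : realType} {N l : nat} (ks : 'I_l -> nat)
    (E : 'I_l -> N.-tuple R) (M : nat)
    (D : forall i : 'I_l, (ks i).-tuple nat) : R :=
  \sum_(1 <= n < M.+1)
    \prod_(i < l) \prod_(j < ks i) term (E i) (n + tnth (D i) j).

Definition cross_values {R : realType} {S : finType} {N : nat}
    (G : S -> N.-tuple R) (k : nat) : set R :=
  [set v | exists (l : nat) (ks : 'I_l -> nat) (s : 'I_l -> S) (M : nat)
             (D : forall i : 'I_l, (ks i).-tuple nat),
     [/\ [/\ (1 <= l)%N, (forall i, (1 <= ks i)%N)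
           & (\sum_(i < l) ks i)%N = k],
         injective s, (1 <= M)%N, admissible N M D
       & v = `|cross_sum (G \o s) M D| ] ].

(* The supremum is a maximum: see [cross_correlation_max]. *)
Definition cross_correlation {R : realType} {S : finType} {N : nat}
    (G : S -> N.-tuple R) (k : nat) : R :=
  sup (cross_values G k).

Definition mutually_independent {d : measure_display} {T : measurableType d}
    {R : realType} (P : probability T R) (I : finType)
    (X : I -> {RV P >-> R}) : Prop :=
  forall (J : {set I}) (B : I -> set R), (forall i, measurable (B i)) ->
    P (\bigcap_(i in [set` J]) (X i @^-1` B i)) =
    (\prod_(i in J) P (X i @^-1` B i))%E.

Arguments mutually_independent {d T R} P {I} X.

(* e s n, with n : 'I_N, is the random sign of index n + 1 of the sequence
   assigned to s. *)
Definition uniform_independent_signs {d : measure_display}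
    {T : measurableType d} {R : realType} (P : probability T R)
    (S : finType) (N : nat) (e : S -> 'I_N -> {RV P >-> R}) : Prop :=
  [/\ forall s n w, e s n w = 1 \/ e s n w = -1,
      forall s n, P [set w | e s n w = 1] = (2^-1)%:E /\
                  P [set w | e s n w = -1] = (2^-1)%:E
    & mutually_independent P (fun sn : S * 'I_N => e sn.1 sn.2)].

Arguments uniform_independent_signs {d T R} P {S N} e.

Definition generator_of {d : measure_display} {T : measurableType d}
    {R : realType} {P : probability T R} {S : finType} {N : nat}
    (e : S -> 'I_N -> {RV P >-> R}) (w : T) (s : S) : N.-tuple R :=
  [tuple e s n w | n < N].

Lemma cross_values_neq0 (R : realType) (S : finType) (N : nat)
    (G : S -> N.-tuple R) (k : nat) :
  (0 < #|S|)%N -> (1 <= k <= N)%N -> cross_values G k !=set0.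
Proof.
move=> /card_gt0P[s0 _] /andP[k0 kN].
pose D : forall i : 'I_1, k.-tuple nat := fun=> [tuple of iota 0 k].
exists `|cross_sum (ks := fun=> k) (G \o fun=> s0) 1 D|.
exists 1%N, (fun=> k), (fun=> s0), 1%N, D; split => //.
- by split => //; rewrite big_ord1.
- by move=> i j _; rewrite !ord1.
- move=> i; split; rewrite ?iota_ltn_sorted //=.
  have -> : last 0%N (iota 0 k) = k.-1.
    by rewrite -nth_last size_iota nth_iota ?prednK.
  by rewrite add1n prednK.
Qed.

Lemma cross_correlation_max (R : realType) (S : finType) (N : nat)
    (G : S -> N.-tuple R) (k : nat) :
  (forall s n, tnth (G s) n = 1 \/ tnth (G s) n = -1) ->
  (0 < #|S|)%N -> (1 <= k <= N)%N ->
  cross_values G k (cross_correlation G k) /\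
  ubound (cross_values G k) (cross_correlation G k).
Proof.
move=> Gpm S0 kN.
have ub v : cross_values G k v -> exists2 m : nat, (m <= N)%N & v = m%:R.
  move=> [l [ks [s [M [D [[l0 ks0 _] _ M0 adm ->]]]]]].
  have MN : (M <= N)%N.
    by have [_ _] := adm (Ordinal l0); apply: leq_trans; rewrite leq_addr.
  have tpm n : (1 <= n < M.+1)%N -> exists b : bool,
      \prod_(i < l) \prod_(j < ks i) term ((G \o s) i) (n + tnth (D i) j)
      = (-1) ^+ b.
    move=> /andP[n1 nM].
    pose Q x := exists b : bool, x = (-1) ^+ b :> R.
    have Q1 : Q 1 by exists false.
    have QM x y : Q x -> Q y -> Q (x * y).
      by move=> [b ->] [c ->]; exists (b (+) c); rewrite signr_addb.
    apply: (big_ind Q) => // i _; apply: (big_ind Q) => // j _.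
    have [Dsort _ DN] := adm i.
    have Dlast : (tnth (D i) j <= last 0 (D i))%N.
      rewrite (tnth_nth 0%N) -nth_last size_tuple.
      have jk := ltn_ord j.
      have [ij|ij] := ltnP j (ks i).-1; last first.
        have -> // : nat_of_ord j = (ks i).-1.
        by apply/eqP; rewrite eqn_leq ij andbT -ltnS prednK.
      apply: ltnW; apply: (sorted_ltn_nth ltn_trans 0%N Dsort) => //.
        by rewrite inE size_tuple.
      by rewrite inE size_tuple prednK.
    have lt : ((n + tnth (D i) j).-1 < N)%N.
      rewrite prednK ?addn_gt0 ?n1 //.
      by apply: leq_trans DN; apply: leq_add.
    rewrite /term /= -(tnth_nth 0 (G (s i)) (Ordinal lt)).
    by case: (Gpm (s i) (Ordinal lt)) => ->; [exists false|exists true].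
  have [z [zE zM]] : exists z : int, cross_sum (G \o s) M D = z%:~R /\
      (`|z| <= M)%N.
    rewrite /cross_sum.
    have : forall m, (m <= M)%N -> exists z : int,
        \sum_(1 <= n < m.+1) \prod_(i < l) \prod_(j < ks i)
          term ((G \o s) i) (n + tnth (D i) j) = z%:~R /\ (`|z| <= m)%N.
      elim=> [_|m IH mM]; first by exists 0; rewrite big_geq.
      have [z [zE zm]] := IH (ltnW mM).
      have [b bE] := tpm m.+1 (mM : (1 <= m.+1 < M.+1)%N).
      exists (z + (-1) ^+ b); split.
        by rewrite big_nat_recr //= zE bE intrD rmorph_sign.
      rewrite -lez_nat abszE (le_trans (ler_normD _ _)) //.
      by rewrite normr_sign -addn1 PoszD lerD2r -abszE lez_nat.
    exact.
  exists `|z|%N; first exact: leq_trans zM MN.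
  by rewrite zE -intr_norm -abszE.
pose p (m : nat) := `[< cross_values G k m%:R >].
have exp : exists m, p m.
  have [v hv] := cross_values_neq0 G S0 kN.
  by have [m _ vm] := ub _ hv; exists m; apply/asboolP; rewrite -vm.
have pN m : p m -> (m <= N)%N.
  by move=> /asboolP /ub[m' m'N /eqP]; rewrite eqr_nat => /eqP ->.
case: (ex_maxnP exp pN) => m /asboolP pm mmax.
have mub : ubound (cross_values G k) m%:R.
  move=> v hv; have [m' _ vm] := ub _ hv.
  by rewrite vm ler_nat mmax //; apply/asboolP; rewrite -vm.
suff -> : cross_correlation G k = m%:R by [].
apply/eqP; rewrite eq_le; apply/andP; split.
- by apply: ge_sup => //; exists m%:R.
- by apply: ub_le_sup => //; exists m%:R.
Qed.

(* Main.v *)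
Require Import Defs.
From mathcomp Require Import all_boot all_order all_algebra.
From mathcomp Require Import all_classical all_reals all_analysis.
From mathcomp Require Import ring lra zify.

Set Implicit Arguments.
Unset Strict Implicit.
Unset Printing Implicit Defensive.

Import Order.TTheory GRing.Theory Num.Theory.

Local Open Scope classical_set_scope.
Local Open Scope ring_scope.

(** Why the theorem holds.

    A choice of blocks (k_i, s_i, D^i) is the same thing as a set U of k
    positions (s, d) in the S x N array of signs, and the sum V is the
    correlation of U over M shifts: the sum over n < M of the product of the
    signs at (s, d + n), for (s, d) in U ([cross_values_correlation]). So
    everything is a statement about uniformly random Boolean arrays, a finite
    probability space.

    For a single U the M shifted products are independent fair signs: each
    shifted copy contains the shift of a leftmost position of U, and no later
    copy does ([pivoted_shifts]). Write L = ln (binom N k) + k ln |S|.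

    Upper bound. By Hoeffding's inequality each correlation reaches
    (5/2) sqrt (N L) with probability at most 2 exp (- (25/8) L). There are at
    most N values of M and binom (|S| N) k <= exp (2 L) sets U, and
    L >= 2 ln N, so the union bound leaves 2 N exp (- (9/8) L)
    <= 2 N^(-5/4) ([prob_some_correlation_ge]), which is summable over k <= N.

    Lower bound. Take M close to N/2, fix one sequence t0, and consider only
    the sets U that contain (t0, 0) and whose other k - 1 positions avoid t0 and
    have column at most N - M. For two different such sets U and V the
    products belonging to U and those belonging to V are jointly independent:
    the sign at (t0, n) occurs in the n-th product of each and nowhere else,
    and it cancels in their quotient, which is the n-th product of the
    symmetric difference of U and V ([mean_shifts_pair]). The events that the
    correlation exceeds (2/5) sqrt (N L) are thus pairwise independent of equal
    probability p, and Chebyshev's inequality bounds the probability that none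
    occurs by 1 / (D p), with D the number of such sets ([second_moment],
    [prob_no_anchored_le]). A single binomial term already gives
    p >= exp (- 0.21 L - 4) / sqrt N ([signed_sum_tail_ge]). For k <= 100 the
    crude bound D >= c (|S| N)^(k - 1) makes D p at least a constant times
    N^0.08, and for k > 100 one has D >= exp (L / 4), which makes D p much
    larger than N. Summing the failures over all k therefore gives a quantity
    that tends to 0, uniformly in S ([prob_some_order_fails],
    [failure_rate_cvg]). *)

(** * Estimates for exponentials, logarithms and binomial coefficients *)

Section RealBounds.
Variable R : realType.
Implicit Types (x a u : R) (n k m t : nat).

Lemma partial_exp_le x n : 0 <= x -> \sum_(0 <= i < n) x ^+ i / i`!%:R <= expR x.
Proof.
move=> x0.
apply: (nondecreasing_cvgn_le (u_ := series (exp_coeff x))).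
  by apply: nondecreasing_series => i _ _; exact: exp_coeff_ge0.
exact: is_cvg_series_exp_coeff.
Qed.

Lemma expn_fact_leq i : (2 ^ i * i`! <= (i.*2)`!)%N.
Proof.
elim: i => // i IH; rewrite doubleS !factS expnS.
have := leq_mul (leqnn (i.*2.+2 * 1)%N) IH.
rewrite muln1 => H.
suff : (i.*2.+2 * (2 ^ i * i`!) <= i.*2.+2 * (i.*2.+1 * (i.*2)`!))%N.
  by apply: leq_trans; rewrite -mul2n; nia.
apply: leq_trans H _; rewrite leq_mul2l; apply/orP; right.
by rewrite mulSn leq_addr.
Qed.

(** The Taylor coefficients of both sides are compared one by one: the even
    ones are 1 / (2 i)! on the left and 1 / (2 ^ i i!) on the right. *)
Lemma cosh_le a : (expR a + expR (- a)) / 2 <= expR (a ^+ 2 / 2).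
Proof.
pose s := series (exp_coeff a) \+ series (exp_coeff (- a)).
(* In partial sums of even length the odd powers of a and - a cancel. *)
have s2E n : s n.*2 = 2 * \sum_(0 <= i < n) a ^+ (i.*2) / (i.*2)`!%:R.
  rewrite /s/= /series/= /exp_coeff/=.
  elim: n => [|n IH]; first by rewrite !big_geq// addr0 mulr0.
  rewrite doubleS !big_nat_recr//= mulrDr -IH.
  have e1 : (- a) ^+ n.*2 = a ^+ n.*2 by rewrite exprNn -signr_odd odd_double mul1r.
  have e2 : (- a) ^+ n.*2.+1 = - a ^+ n.*2.+1 by rewrite !exprS e1 mulNr.
  by rewrite e1 e2 mulNr; ring.
have cs : s @ \oo --> expR a + expR (- a).
  by apply: cvgD; exact: is_cvg_series_exp_coeff.
have cs2 : (fun n => s n.*2) @ \oo --> expR a + expR (- a).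
  apply: (cvg_comp _ _ _ cs); apply/cvgnyPge => A.
  near=> n; rewrite -addnn; apply: leq_trans (leq_addr _ _).
  by near: n; exact: nbhs_infty_ge.
suff H : expR a + expR (- a) <= 2 * expR (a ^+ 2 / 2) by lra.
rewrite -(cvg_lim _ cs2)//; apply: limr_le; first exact: cvgP cs2.
near=> n.
apply: (@le_trans _ _ (2 * \sum_(0 <= i < n) (a ^+ 2 / 2) ^+ i / i`!%:R)); last first.
  by rewrite ler_pM2l// partial_exp_le// divr_ge0// sqr_ge0.
rewrite s2E ler_pM2l//; apply: ler_sum => i _.
rewrite expr_div_n -exprM mul2n -mulrA ler_wpM2l//.
  by rewrite -mul2n exprM exprn_ge0// sqr_ge0.
rewrite -invfM lef_pV2 ?posrE ?ltr0n ?fact_gt0 ?mulr_gt0 ?exprn_gt0 ?ltr0n ?fact_gt0//.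
by rewrite -natrX -natrM ler_nat expn_fact_leq.
Unshelve. all: by end_near.
Qed.

(** In the form (1 - u) / (1 + u) >= exp (- (13/5) u) this bounds the ratio of
    consecutive binomial coefficients at relative distance u from the centre.
    The best rate near u = 0 is 2; 13/5 is large enough up to u = 13/20, which
    covers all deviations of the main proof, and small enough to lose to the
    number of position sets. *)
Lemma onem_expR_ge u : 0 <= u -> u <= 13 / 20 ->
  1 + u <= (1 - u) * expR (13 / 5 * u).
Proof.
move=> u0 u1.
have h : 1 + (13/5*u) + (13/5*u)^+2/2 + (13/5*u)^+3/6 <= expR (13/5*u).
  apply: le_trans (@partial_exp_le _ 4 _); last by lra.
  by rewrite !big_nat_recr//= big_geq// !factS fact0 !expr0; lra.
have h1 : 0 <= 1 - u by lra.
apply: le_trans (ler_wpM2l h1 h).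
have h2 : 0 <= u * u by nra.
suff : 0 <= u * (3/5 + 39/50 * u - 451/1000 * (u*u) - 2929/1000 * (u*u*u)).
  by move=> H; nra.
have h3 : u * u <= 13/20 * u by nra.
have h4 : u * u * u <= 169/400 * u by nra.
apply: mulr_ge0; first exact: u0.
move: h3 h4; set v := u * u; set w := v * u => h3 h4; lra.
Qed.

Lemma ln2_le : ln (2 : R) <= 7 / 10.
Proof.
rewrite -ler_expR lnK ?posrE//.
apply: le_trans (@partial_exp_le _ 4 _); last by lra.
by rewrite !big_nat_recr//= big_geq// !factS fact0 !expr0; lra.
Qed.

Lemma ln6_le : ln (6 : R) <= 2.
Proof.
rewrite -ler_expR lnK ?posrE//.
apply: le_trans (@partial_exp_le _ 6 _); last by lra.
by rewrite !big_nat_recr//= big_geq// !factS fact0 !expr0; lra.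
Qed.

Lemma ln12_ge : 23 / 10 <= ln (12 : R).
Proof.
rewrite -ler_expR lnK ?posrE//.
(* exp (- 23/10) is the 23rd power of exp (- 1/10) >= 9/10. *)
have h : (9/10) ^+ 23 <= expR (- (23/10) : R).
  have -> : - (23/10) = 23%:R * (- (1/10)) :> R by lra.
  rewrite expRM_natl; apply: lerXn2r; rewrite ?nnegrE ?expR_ge0//.
  by apply: le_trans (expR_ge1Dx _); lra.
have h2 : 1 / 12 <= expR (- (23/10) : R).
  by apply: le_trans h; rewrite !exprS expr0; lra.
have h3 : expR (- (23/10)) * expR (23/10) = 1 :> R by rewrite -expRD addNr expR0.
have h4 : 0 < expR (23/10) :> R by exact: expR_gt0.
nra.
Qed.

(** The quotient n ^ n / n! is one term of the power series of exp n. *)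
Lemma expn_fact_le n : (n%:R : R) ^+ n <= n`!%:R * expR n%:R.
Proof.
rewrite mulrC -ler_pdivrMr ?ltr0n ?fact_gt0//.
apply: le_trans (@partial_exp_le _ n.+1 _); last by [].
rewrite big_nat_recr//= lerDr sumr_ge0//.
Qed.

(** Factor by factor, (n - i) / (k - i) >= n / k. *)
Lemma expn_leq_binM n k : (k <= n)%N -> (n ^ k <= 'C(n, k) * k ^ k)%N.
Proof.
move=> kn.
rewrite -(leq_pmul2r (fact_gt0 k)) mulnAC bin_ffact.
rewrite -(ffactnn k) !ffact_prod.
have E c : (c ^ k = \prod_(i < k) c)%N by rewrite prod_nat_const card_ord.
rewrite !E -!big_split/=; apply: leq_prod => i _.
have := ltn_ord i; nia.
Qed.

Lemma bin_fact_leq n k : ('C(n, k) * k`! <= n ^ k)%N.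
Proof.
rewrite bin_ffact ffact_prod.
have -> : (n ^ k = \prod_(i < k) n)%N by rewrite prod_nat_const card_ord.
by apply: leq_prod => i _; rewrite leq_subr.
Qed.

Lemma leq_bin2r n j k : (j <= k)%N -> (k.*2 <= n)%N -> ('C(n, j) <= 'C(n, k))%N.
Proof.
move=> /subnK <-; elim: (k - j)%N => // i IH h.
apply: leq_trans (IH _) _; first by lia.
rewrite -(leq_pmul2l (ltn0Sn (i + j))) addSn mul_bin_left leq_mul2r.
by apply/orP; right; lia.
Qed.

Lemma ln_bin_ge n k : (0 < k)%N -> (k <= n)%N ->
  k%:R * ln (n%:R / k%:R) <= ln ('C(n, k)%:R : R).
Proof.
move=> k0 kn.
have n0 : (0 < n)%N by apply: leq_trans kn.
rewrite mulr_natl -lnXn ?divr_gt0 ?ltr0n// ler_ln ?posrE ?exprn_gt0 ?divr_gt0 ?ltr0n ?bin_gt0//.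
rewrite expr_div_n ler_pdivrMr ?exprn_gt0 ?ltr0n//.
by rewrite -!natrX -natrM ler_nat expn_leq_binM.
Qed.

Lemma ln_bin_le n k : (0 < k)%N -> (k <= n)%N ->
  ln ('C(n, k)%:R : R) <= k%:R * (1 + ln (n%:R / k%:R)).
Proof.
move=> k0 kn.
have n0 : (0 < n)%N by apply: leq_trans kn.
have -> : 1 + ln (n%:R / k%:R) = ln (expR 1 * (n%:R / k%:R)) :> R.
  by rewrite lnM ?posrE ?expR_gt0 ?divr_gt0 ?ltr0n// expRK.
have p0 : 0 < expR 1 * (n%:R / k%:R) :> R by rewrite mulr_gt0 ?expR_gt0 ?divr_gt0 ?ltr0n.
rewrite mulr_natl -lnXn// ler_ln ?posrE ?exprn_gt0 ?ltr0n ?bin_gt0//.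
rewrite exprMn -expRM_natr mul1r expr_div_n mulrA ler_pdivlMr ?exprn_gt0 ?ltr0n//.
apply: (@le_trans _ _ ('C(n, k)%:R * (k`!%:R * expR k%:R))).
  by rewrite ler_wpM2l// expn_fact_le.
rewrite mulrA mulrC ler_wpM2l ?expR_ge0//.
by rewrite -natrM -natrX ler_nat bin_fact_leq.
Qed.

(** Passing from m to m + 1 multiplies the squared coefficient by
    4 (2 m + 1)^2 / (m + 1)^2, which is at least 16 m / (m + 1). *)
Lemma central_bin_leq m : (0 < m)%N -> (16 ^ m <= 4 * m * 'C(m.*2, m) ^ 2)%N.
Proof.
elim: m => // -[_ _//|m IH _].
move: (IH isT) => {}IH.
set n := m.+1 in IH *.
have e1 : (n.+1 * 'C(n.+1.*2, n.+1) = 2 * (n.*2.+1) * 'C(n.*2, n))%N.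
  have h1 := mul_bin_diag n.+1.*2 n.
  have h2 := mul_bin_down n.*2.+1 n.
  rewrite doubleS /= in h1 h2 *.
  have e : (n.*2.+1 - n = n.+1)%N by lia.
  rewrite e in h2.
  have : (n.*2.+2 = 2 * n.+1)%N by lia.
  move=> e3; rewrite e3 in h1 *.
  nia.
have n0 : (0 < n.+1)%N by [].
rewrite -(leq_pmul2r n0) expnS.
set c := 'C(n.*2, n) in IH e1; set c' := 'C(_, _) in e1 *.
have -> : (4 * n.+1 * c' ^ 2 * n.+1 = 4 * (n.+1 * c') ^ 2)%N by rewrite !expnS; lia.
rewrite e1.
have : (16 * 16 ^ n * n.+1 <= 16 * (4 * n * c ^ 2) * n.+1)%N.
  by apply: leq_mul => //; apply: leq_mul.
move/leq_trans; apply.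
have -> : (16 * (4 * n * c ^ 2) * n.+1 = 16 * (4 * n * n.+1) * c ^ 2)%N by lia.
have -> : (4 * (2 * n.*2.+1 * c) ^ 2 = 16 * (n.*2.+1 ^ 2) * c ^ 2)%N by rewrite !expnS; lia.
by rewrite leq_mul2r leq_mul2l; apply/orP; right; rewrite -mul2n !expnS expn0; nia.
Qed.

(** The step from i - 1 to i multiplies the coefficient by
    (m - i + 1) / (m + i), hence at least by (1 - u) / (1 + u) with u = i / m;
    summing (13/5) i / m over i <= t gives the exponent. *)
Lemma off_central_bin_ge m t : (0 < m)%N -> t%:R <= 13 / 20 * m%:R :> R ->
  'C(m.*2, m)%:R * expR (- (13 / 10 * (t%:R * (t%:R + 1)) / m%:R))
    <= 'C(m.*2, m + t)%:R :> R.
Proof.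
move=> m0; elim: t => [_|t IH ht].
  by rewrite mul0r mulr0 mul0r oppr0 expR0 mulr1 addn0.
have mR : 0 < m%:R :> R by rewrite ltr0n.
have t0 : 0 <= t%:R :> R by [].
rewrite -natr1 in ht *.
have {}IH := IH ltac:(lra).
have e : (m + t.+1)%:R * 'C(m.*2, m + t.+1)%:R = (m%:R - t%:R) * 'C(m.*2, m + t)%:R :> R.
  have tm : (t <= m)%N by rewrite -(ler_nat R); lra.
  rewrite -natrB// -!natrM addnS mul_bin_left; congr (_ * _)%:R; lia.
pose u : R := (t%:R + 1) / m%:R.
have um : t%:R + 1 = u * m%:R by rewrite /u divfK// gt_eqF.
have u0 : 0 <= u by rewrite divr_ge0//; lra.
have u1 : u <= 13/20 by rewrite ler_pdivrMr.
have H := onem_expR_ge u0 u1.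
have -> : - (13 / 10 * ((t%:R + 1) * (t%:R + 1 + 1)) / m%:R) =
   - (13 / 10 * (t%:R * (t%:R + 1)) / m%:R) - 13/5 * u.
  rewrite /u; field; by rewrite gt_eqF.
rewrite expRD mulrA.
set x := 'C(m.*2, m)%:R * _ in IH *.
have x0 : 0 <= x by rewrite mulr_ge0 ?expR_ge0.
have E1 : expR (- (13/5*u)) * expR (13/5*u) = 1 by rewrite -expRD addNr expR0.
have E0 := expR_gt0 (- (13/5*u)).
set z := expR (- (13/5*u)) in E1 E0 *.
have Hz : z * (1 + u) <= 1 - u.
  by have := ler_wpM2l (ltW E0) H; rewrite mulrCA E1 mulr1.
have M0 : 0 < (m + t.+1)%:R :> R by rewrite ltr0n addnS.
rewrite -(ler_pM2l M0) e natrD -natr1 um.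
have -> : (m%:R - t%:R) = m%:R * (1 - u) + 1 by rewrite mulrBr mulr1 [m%:R * u]mulrC -um; ring.
set y := 'C(_, _)%:R in IH *.
have : m%:R * (1 - u) * x <= (m%:R * (1 - u) + 1) * y.
  have c0 : 0 <= m%:R * (1 - u) by rewrite mulr_ge0//; lra.
  have y0 : 0 <= y by rewrite /y.
  by have := ler_wpM2l c0 IH; lra.
apply: le_trans.
have -> : (m%:R + u * m%:R) * (x * z) = (z * (1 + u)) * (m%:R * x) by ring.
have -> : m%:R * (1 - u) * x = (1 - u) * (m%:R * x) by ring.
by rewrite ler_wpM2r// mulr_ge0.
Qed.

End RealBounds.

(** * Means over a finite uniform probability space *)

Section FiniteMean.
Variables (R : realType) (Omega : finType).
Hypothesis Omega_gt0 : (0 < #|Omega|)%N.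
Implicit Types (f g : Omega -> R) (A : pred Omega).

Definition mean f : R := (\sum_x f x) / #|Omega|%:R.

Definition prob A : R := mean (fun x => (A x)%:R).

Lemma eq_mean f g : f =1 g -> mean f = mean g.
Proof. by move=> fg; rewrite /mean (eq_bigr g). Qed.

Lemma le_mean f g : (forall x, f x <= g x) -> mean f <= mean g.
Proof. by move=> fg; rewrite ler_wpM2r ?invr_ge0// ler_sum. Qed.

Lemma meanD f g : mean (fun x => f x + g x) = mean f + mean g.
Proof. by rewrite /mean big_split/= mulrDl. Qed.

Lemma meanZ c f : mean (fun x => c * f x) = c * mean f.
Proof. by rewrite /mean -mulr_sumr mulrA. Qed.

Lemma mean_cst c : mean (fun=> c) = c.
Proof.
rewrite /mean sumr_const -[c *+ _]mulr_natr mulfK//.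
by rewrite pnatr_eq0 -lt0n.
Qed.

Lemma mean_sum (I : Type) (r : seq I) (P : pred I) (F : I -> Omega -> R) :
  mean (fun x => \sum_(i <- r | P i) F i x) = \sum_(i <- r | P i) mean (F i).
Proof. by rewrite /mean exchange_big/= mulr_suml. Qed.

Lemma prob_exists_le (I : finType) (P : pred I) (B : I -> pred Omega) :
  prob (fun x => [exists i, P i && B i x]) <= \sum_(i | P i) prob (B i).
Proof.
rewrite /prob -mean_sum; apply: le_mean => x.
case: existsP => [[i /andP[Pi Bi]]|_]; last by rewrite sumr_ge0.
by rewrite (bigD1 i)//= Bi lerDl sumr_ge0.
Qed.

Lemma mean_reindex (tau : Omega -> Omega) f : injective tau ->
  mean (fun x => f (tau x)) = mean f.
Proof. by move=> it; rewrite /mean [in RHS](reindex_inj it). Qed.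

(** Chebyshev's inequality for the number Y of events that occur: pairwise
    independence bounds the mean of (Y - e)^2 by the mean e = #|D| p of Y, and
    (Y - e)^2 = e^2 wherever no event occurs. *)
Lemma second_moment (J : finType) (D : {set J}) (I : J -> pred Omega) (p : R) :
  0 < p -> (0 < #|D|)%N ->
  (forall i, i \in D -> prob (I i) = p) ->
  (forall i j, i \in D -> j \in D -> i != j ->
     mean (fun x => (I i x)%:R * (I j x)%:R) = p ^+ 2) ->
  prob (fun x => [forall i in D, ~~ I i x]) <= (#|D|%:R * p)^-1.
Proof.
move=> p0 D0 Ip Ipp.
pose Y x : R := \sum_(i in D) (I i x)%:R.
pose e : R := #|D|%:R * p.
have e0 : 0 < e by rewrite mulr_gt0// ltr0n.
have mY : mean Y = e.
  by rewrite /Y /e mean_sum (eq_bigr (fun=> p))// sumr_const mulr_natl.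
have mY2 : mean (fun x => Y x * Y x) <= e + e ^+ 2.
  rewrite (eq_mean (g := fun x => \sum_(i in D) \sum_(j in D) (I i x)%:R * (I j x)%:R)); last first.
    by move=> x; rewrite /Y mulr_suml; apply: eq_bigr => i _; rewrite mulr_sumr.
  rewrite mean_sum.
  apply: (@le_trans _ _ (\sum_(i in D) (p + #|D|%:R * p ^+ 2))).
    apply: ler_sum => i iD; rewrite mean_sum (bigD1 i)//=; apply: lerD.
      rewrite -(Ip i iD); apply: le_mean => x; case: (I i x); rewrite ?mulr1 ?mulr0//.
    rewrite (eq_bigr (fun=> p ^+ 2)); last by move=> j /andP[jD ji]; rewrite Ipp// eq_sym.
    rewrite sumr_const -[_ *+ _]mulr_natl ler_wpM2r ?exprn_ge0 ?(ltW p0)// ler_nat.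
    by apply: subset_leq_card; apply/fintype.subsetP => j /andP[].
  by rewrite sumr_const -[_ *+ _]mulr_natl /e; nra.
have key : e ^+ 2 * prob (fun x => [forall i in D, ~~ I i x]) <= e.
  have : mean (fun x => Y x * Y x + (-2 * e) * Y x + e ^+ 2) <= e.
    by rewrite !meanD meanZ mY mean_cst; lra.
  apply: le_trans; rewrite /prob -meanZ; apply: le_mean => x.
  case: (boolP [forall i in D, _]) => [/'forall_implyP H|_].
    suff -> : Y x = 0 by rewrite mulr1; lra.
    by apply: big1 => i iD; have := H i iD; case: (I i x).
  by rewrite mulr0; have := sqr_ge0 (Y x - e); lra.
rewrite -(ler_pM2l e0) divff ?gt_eqF// -(ler_pM2l e0) mulr1; move: key; rewrite expr2 mulrA//.
Qed.

(** A certificate that the bits gs are independent and fair: each of them can be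
    flipped by a permutation of the space that leaves all the later ones
    unchanged. *)
Fixpoint pivoted (gs : seq (Omega -> bool)) : Prop :=
  if gs is g :: gs' then
    (exists tau : Omega -> Omega,
       [/\ injective tau, forall x, g (tau x) = ~~ g x
         & forall x, [seq h (tau x) | h <- gs'] = [seq h x | h <- gs']])
    /\ pivoted gs'
  else True.

(** The mean of F over uniform bit sequences of length n, in recursive form so
    that exact evaluations go by induction on n. *)
Fixpoint avg (n : nat) (F : seq bool -> R) : R :=
  if n is n'.+1 then
    (avg n' (fun s => F (true :: s)) + avg n' (fun s => F (false :: s))) / 2
  else F [::].

(** The permutation that flips the first bit preserves the mean, so the mean is
    also that of the average over the two values of the first bit, with the
    remaining bits as they are. *)
Lemma mean_pivoted gs (F : seq bool -> R) : pivoted gs ->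
  mean (fun x => F [seq h x | h <- gs]) = avg (size gs) F.
Proof.
elim: gs F => [|g gs IH] F /=; first by rewrite mean_cst.
move=> [[tau [it gt gst]] pgs].
rewrite -!IH//.
set m := mean _.
have e : m = mean (fun x => F (~~ g x :: [seq h x | h <- gs])).
  rewrite /m -(mean_reindex (fun x => F (g x :: [seq h x | h <- gs])) it).
  by apply: eq_mean => x; rewrite gt gst.
suff : m + m = mean (fun x => F (true :: [seq h x | h <- gs])) +
               mean (fun x => F (false :: [seq h x | h <- gs])) by lra.
rewrite {2}e /m -!meanD; apply: eq_mean => x.
by case: (g x) => //=; rewrite addrC.
Qed.

End FiniteMean.

(** * Sums of independent random signs *)

Section SignSums.
Variable R : realType.
Implicit Types (s t : seq bool) (F G : seq bool -> R) (a b c : R).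

Definition signed_sum s : R := \sum_(b <- s) (-1) ^+ b.

Lemma signed_sum_cons (b : bool) s : signed_sum (b :: s) = (-1) ^+ b + signed_sum s.
Proof. by rewrite /signed_sum big_cons. Qed.

Lemma signed_sum_nil : signed_sum [::] = 0.
Proof. by rewrite /signed_sum big_nil. Qed.

Lemma signed_sum_map (T : Type) (g : T -> bool) (r : seq T) :
  signed_sum [seq g i | i <- r] = \sum_(i <- r) (-1) ^+ g i.
Proof. by rewrite /signed_sum big_map. Qed.

Lemma signed_sum_count s : signed_sum s = 2 * (count negb s)%:R - (size s)%:R.
Proof.
elim: s => [|b s IH]; first by rewrite signed_sum_nil/=; lra.
by rewrite signed_sum_cons IH/= natrD -natr1; case: b => /=; lra.
Qed.

Lemma avg_le n F G : (forall s, size s = n -> F s <= G s) -> avg n F <= avg n G.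
Proof.
elim: n F G => [|n IH] F G FG /=; first exact: FG.
rewrite ler_pM2r//; apply: lerD; apply: IH => s sn; apply: FG => /=; by rewrite sn.
Qed.

Lemma eq_avg n F G : (forall s, size s = n -> F s = G s) -> avg n F = avg n G.
Proof. by move=> FG; apply/le_anti/andP; split; apply: avg_le => s /FG ->. Qed.

Lemma avgZ n c F : avg n (fun s => c * F s) = c * avg n F.
Proof. by elim: n F => //= n IH F; rewrite !IH; lra. Qed.

Lemma avgD n F G : avg n (fun s => F s + G s) = avg n F + avg n G.
Proof. by elim: n F G => //= n IH F G; rewrite !IH; lra. Qed.

Lemma avg_cat m n F :
  avg (m + n) F = avg m (fun s => avg n (fun t => F (s ++ t))).
Proof. by elim: m F => //= m IH F; rewrite !IH. Qed.

Definition xor_seq s t := [seq p.1 (+) p.2 | p <- zip s t].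

Lemma avg_xor s F : avg (size s) (fun t => F (xor_seq s t)) = avg (size s) F.
Proof.
rewrite /xor_seq; elim: s F => //= b s IH F.
rewrite (IH (fun t => F ((b (+) true) :: t))) (IH (fun t => F ((b (+) false) :: t))).
by case: b => //=; rewrite addrC.
Qed.

(** If s and t are independent uniform sequences, then so are s and s + t: for
    fixed s the translation by s permutes the sequences t. *)
Lemma avg_xor_pair m F G :
  avg (m + m) (fun s => F (take m s) * G (xor_seq (take m s) (drop m s))) =
  avg m F * avg m G.
Proof.
rewrite avg_cat [RHS]mulrC -avgZ; apply: eq_avg => s sm.
rewrite mulrC -{5}sm -(avg_xor s) -avgZ sm; apply: eq_avg => t tm.
by rewrite -sm take_size_cat// drop_size_cat.
Qed.

Lemma avg_expR n a :
  avg n (fun s => expR (a * signed_sum s)) = ((expR a + expR (- a)) / 2) ^+ n.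
Proof.
elim: n => [|n IH] /=; first by rewrite signed_sum_nil mulr0 expR0.
have H (b : bool) : avg n (fun s => expR (a * signed_sum (b :: s))) =
    expR (a * (-1) ^+ b) * ((expR a + expR (- a)) / 2) ^+ n.
  by rewrite -IH -avgZ; apply: eq_avg => s _; rewrite signed_sum_cons mulrDr expRD.
by rewrite !H /= expr1 expr0 mulr1 mulrN1 exprS; lra.
Qed.

Lemma avg_expR_le n a : avg n (fun s => expR (a * signed_sum s)) <= expR (n%:R * (a ^+ 2 / 2)).
Proof.
rewrite avg_expR expRM_natl lerXn2r ?nnegrE ?expR_ge0 ?cosh_le//.
Qed.

(** The exponential Markov inequality on both sides, at the optimal parameter
    a = b / n for the bound exp (n a^2 / 2) of the moment generating function. *)
Lemma hoeffding n b : (0 < n)%N -> 0 <= b ->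
  avg n (fun s => (b <= `|signed_sum s|)%R%:R) <= 2 * expR (- (b ^+ 2 / (2 * n%:R))).
Proof.
move=> n0 b0.
have nR : 0 < n%:R :> R by rewrite ltr0n.
pose a := b / n%:R.
have a0 : 0 <= a by rewrite divr_ge0// ltW.
apply: (@le_trans _ _ (avg n (fun s => expR (- (a * b)) *
    (expR (a * signed_sum s) + expR ((- a) * signed_sum s))))).
  apply: avg_le => s _; have [h|h] := leP b; last first.
    by rewrite mulr_ge0 ?addr_ge0 ?expR_ge0.
  have [h'|h'] := leP 0 (signed_sum s).
    rewrite ger0_norm// in h.
    rewrite mulrDr -!expRD -[leLHS]addr0 lerD ?expR_ge0// -expR0 ler_expR.
    by have := ler_wpM2l a0 h; lra.
  rewrite ltr0_norm// in h.
  rewrite mulrDr -!expRD -[leLHS]add0r lerD ?expR_ge0// -expR0 ler_expR.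
  by have := ler_wpM2l a0 h; lra.
rewrite avgZ avgD.
have h1 := avg_expR_le n a; have h2 := avg_expR_le n (- a).
rewrite sqrrN in h2.
have h3 := lerD h1 h2.
have E0 := expR_ge0 (- (a * b)).
apply: le_trans (ler_wpM2l E0 h3) _.
have dbl (z w : R) : z * (w + w) = 2 * (z * w) by ring.
rewrite dbl -expRD ler_pM2l// ler_expR /a le_eqVlt; apply/orP; left; apply/eqP.
by field; rewrite gt_eqF.
Qed.

Lemma avg_count n j : avg n (fun s => (count negb s == j)%:R) = 'C(n, j)%:R / 2 ^+ n :> R.
Proof.
elim: n j => [|n IH] j /=; first by rewrite bin0n expr0 divr1; case: j.
rewrite IH; case: j => [|j].
  have -> : avg n (fun s => (1 + count negb s == 0)%N%:R) = 0 * avg n (fun=> 1) :> R.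
    by rewrite -avgZ; apply: eq_avg => s _; rewrite mul0r.
  by rewrite !bin0 exprS mul0r addr0; field; rewrite expf_neq0.
have -> : avg n (fun s => (1 + count negb s == j.+1)%N%:R) = avg n (fun s => (count negb s == j)%:R) :> R.
  by apply: eq_avg.
by rewrite IH binS natrD exprS; field; rewrite expf_neq0.
Qed.

End SignSums.

(** * Correlations of position sets *)

Section Shifts.
Variables (R : realType) (S : finType) (N : nat).
Local Notation X := (S * 'I_N)%type.
Local Notation Omega := {ffun X -> bool}.
Implicit Types (x : Omega) (U V Z : {set X}) (p u : X) (n m M a : nat).

(** The value for j >= N is a placeholder: shifts never leave the array in the
    correlations that are considered. *)
Definition bit x (t : S) (j : nat) : bool :=
  if insub j is Some i then x (t, i) else false.

Definition shift_parity U n x : bool :=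
  \big[addb/false]_(u in U) bit x u.1 (u.2 + n).

Definition shift_parities U M x : seq bool :=
  [seq shift_parity U n x | n <- iota 0 M].

Definition correlation U M x : R :=
  \sum_(0 <= n < M) (-1) ^+ shift_parity U n x.

Definition fits U M := forall u, u \in U -> (u.2 + M <= N)%N.

Definition flip p x : Omega := [ffun q => x q (+) (q == p)].

Lemma flip_inj p : injective (flip p).
Proof.
by apply: inv_inj => x; apply/ffunP => q; rewrite !ffunE -addbA addbb addbF.
Qed.

Lemma bit_flip p x t j :
  bit (flip p x) t j = bit x t j (+) ((t == p.1) && (j == p.2)).
Proof.
rewrite /bit; case: insubP => [i _ <-|jN]; first by rewrite ffunE -pair_eqE/=.
have [jp|] := eqVneq j p.2; last by rewrite andbF.
by rewrite jp ltn_ord in jN.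
Qed.

Lemma shift_parity_flip_in p x U n u : u \in U -> u.1 = p.1 -> (u.2 + n)%N = p.2 ->
  shift_parity U n (flip p x) = ~~ shift_parity U n x.
Proof.
move=> uU u1 u2; rewrite /shift_parity (bigD1 u)//= [in RHS](bigD1 u)//=.
rewrite bit_flip u1 u2 !eqxx /= addbT addNb; congr (~~ (_ (+) _)).
apply: eq_bigr => v /andP[vU vu]; rewrite bit_flip.
have [v1|] := eqVneq v.1 p.1; last by rewrite addbF.
have [v2|] := eqVneq (v.2 + n)%N p.2; last by rewrite addbF.
case/negP: vu; rewrite -pair_eqE /pair_eq/= v1 u1 eqxx/=.
by rewrite -val_eqE/= -(eqn_add2r n) v2 u2.
Qed.

Lemma shift_parity_flip_notin p x U n :
  (forall u, u \in U -> u.1 = p.1 -> (u.2 + n)%N <> p.2) ->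
  shift_parity U n (flip p x) = shift_parity U n x.
Proof.
move=> H; apply: eq_bigr => v vU; rewrite bit_flip.
have [v1|] := eqVneq v.1 p.1; last by rewrite addbF.
by case: eqP => [v2|]; [case: (H v)|rewrite addbF].
Qed.

(** Let u be an element of U with the smallest column. The n-th shift contains
    the position of u moved by n, and no later shift does, because all its
    elements in that row lie further right: flipping this position changes the
    n-th parity and none of the later ones. *)
Lemma pivoted_shifts U a M : U != finset.set0 ->
  (forall u, u \in U -> (u.2 + (a + M) <= N)%N) ->
  pivoted [seq shift_parity U n | n <- iota a M].
Proof.
move=> /set0Pn[u' u'U].
case: (arg_minnP (P := [in U]) (fun u : X => val u.2) u'U) => u uU umin.
elim: M a => [|M IH] a fU //=; split; last by apply: IH => v /fU; rewrite addnS addSn.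
have lt : (u.2 + a < N)%N.
  by have := fU u uU; move: (nat_of_ord u.2) => w; lia.
exists (flip (u.1, Ordinal lt)); split; first exact: flip_inj.
  by move=> x; apply: (shift_parity_flip_in x uU).
move=> x; rewrite -!map_comp; apply/eq_in_map => n; rewrite mem_iota => /andP[an _] /=.
apply: shift_parity_flip_notin => v vU _ /= e.
have := umin v vU; move: e; rewrite /=; move: (nat_of_ord u.2) (nat_of_ord v.2) => w w'; lia.
Qed.

(** When U has a single element u0 in row t0 and Z has none, the position of u0
    moved by n is met by the n-th shift of U and by no other shift of U or
    Z. *)
Lemma pivoted_shifts_cat U Z (t0 : S) (u0 : X) a m M :
  u0 \in U -> u0.1 = t0 -> (forall u, u \in U -> u.1 = t0 -> u = u0) ->
  (forall u, u \in Z -> u.1 <> t0) -> (u0.2 + (a + m) <= N)%N ->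
  pivoted [seq shift_parity Z n | n <- iota 0 M] ->
  pivoted ([seq shift_parity U n | n <- iota a m] ++
           [seq shift_parity Z n | n <- iota 0 M]).
Proof.
move=> uU u1 uniqU Zt0 + pZ; elim: m a => [|m IH] a fU //=.
split; last by apply: IH; move: fU; rewrite addnS addSn.
have lt : (u0.2 + a < N)%N by move: fU; move: (nat_of_ord u0.2) => w; lia.
exists (flip (t0, Ordinal lt)); split; first exact: flip_inj.
  by move=> x; apply: (shift_parity_flip_in x uU).
move=> x; rewrite !map_cat -!map_comp; congr (_ ++ _); apply/eq_in_map => n;
  rewrite mem_iota => /andP[an _] /=; apply: shift_parity_flip_notin => v vU /= v1.
  by rewrite (uniqU v vU v1); move: (nat_of_ord u0.2) => w; lia.
by case: (Zt0 v vU v1).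
Qed.

Lemma shift_parity_xor U V Z n x :
  (forall u, (u \in Z) = (u \in U) (+) (u \in V)) ->
  shift_parity V n x = shift_parity U n x (+) shift_parity Z n x.
Proof.
move=> Zdef; rewrite /shift_parity [LHS]big_mkcond [X in X (+) _]big_mkcond [X in _ (+) X]big_mkcond -big_split/=; apply: eq_bigr => u _.
by rewrite Zdef; case: (u \in U); case: (u \in V); rewrite ?addbb ?addbF.
Qed.

Lemma card_Omega_gt0 : (0 < #|{: Omega}|)%N.
Proof. by apply/card_gt0P; exists [ffun=> false]. Qed.

(** The shifted parities of one set are independent fair bits. *)
Lemma mean_shifts U M (F : seq bool -> R) : U != finset.set0 -> fits U M ->
  mean (fun x => F (shift_parities U M x)) = avg M F.
Proof.
move=> U0 fU; have := mean_pivoted card_Omega_gt0 F (pivoted_shifts (a := 0) U0 fU).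
rewrite size_map size_iota => <-; apply: eq_mean => x.
by rewrite /shift_parities -map_comp.
Qed.

(** Joint independence of the parities of two sets with the same single element
    in row t0. The parities of V are those of U plus those of the symmetric
    difference Z; row t0 cancels in Z, so the parities of U and of Z together
    are independent, and so are those of U and of V. *)
Lemma mean_shifts_pair U V (t0 : S) (u0 : X) M (F G : seq bool -> R) :
  u0 \in U -> u0 \in V -> u0.1 = t0 ->
  (forall u, u \in U -> u.1 = t0 -> u = u0) ->
  (forall u, u \in V -> u.1 = t0 -> u = u0) ->
  fits U M -> fits V M -> U != V ->
  mean (fun x => F (shift_parities U M x) * G (shift_parities V M x)) =
  avg M F * avg M G.
Proof.
move=> uU uV u1 uniqU uniqV fU fV UV.
pose Z := [set u | (u \in U) (+) (u \in V)]%SET.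
have Zdef u : (u \in Z) = (u \in U) (+) (u \in V) by rewrite inE.
have Z0 : Z != finset.set0.
  apply: contra UV => /eqP Z0; apply/eqP/setP => u.
  by have := Zdef u; rewrite Z0 inE; case: (u \in U); case: (u \in V).
have fZ : forall u, u \in Z -> (u.2 + (0 + M) <= N)%N.
  move=> u; rewrite Zdef add0n; case: (boolP (u \in U)) => [/fU//|_] /= /fV //.
have pZ := pivoted_shifts Z0 fZ.
have Zt0 u : u \in Z -> u.1 <> t0.
  rewrite Zdef => h ut; move: h.
  case: (boolP (u \in U)) => [uU'|nU].
    by rewrite (uniqU u uU' ut) uV.
  by move=> /= uV'; move: nU; rewrite (uniqV u uV' ut) uU.
have := mean_pivoted card_Omega_gt0
  (fun s => F (take M s) * G (xor_seq (take M s) (drop M s)))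
  (pivoted_shifts_cat (a := 0) uU u1 uniqU Zt0 (fU _ uU) pZ).
rewrite size_cat !size_map !size_iota avg_xor_pair => <-; apply: eq_mean => x.
rewrite map_cat -!map_comp.
rewrite take_size_cat ?size_map ?size_iota// drop_size_cat ?size_map ?size_iota//.
congr (_ * G _); rewrite /xor_seq /shift_parities zip_map -map_comp.
by apply: eq_map => n /=; exact: shift_parity_xor.
Qed.

Lemma correlationE U M x : correlation U M x = signed_sum R (shift_parities U M x).
Proof. by rewrite signed_sum_map /correlation /index_iota subn0. Qed.

Lemma correlation_tail U M (b : R) : U != finset.set0 -> fits U M -> (0 < M)%N -> 0 <= b ->
  prob R (fun x => b <= `|correlation U M x|) <= 2 * expR (- (b ^+ 2 / (2 * M%:R))).
Proof.
move=> U0 fU M0 b0; apply: le_trans (hoeffding M0 b0); rewrite -(mean_shifts _ U0 fU).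
by apply: le_mean => x; rewrite correlationE.
Qed.

End Shifts.

(** * Cross-correlation values are correlations of position sets *)

Section CrossValues.
Variables (R : realType) (S : finType) (N : nat).
Local Notation X := (S * 'I_N)%type.
Local Notation Omega := {ffun X -> bool}.
Implicit Types (x : Omega) (U : {set X}) (k M : nat).

Definition sign_sequences x (t : S) : N.-tuple R :=
  [tuple (-1) ^+ x (t, n) | n < N].

Lemma term_sign_sequences x t n : (n < N)%N ->
  term (sign_sequences x t) n.+1 = (-1) ^+ bit x t n.
Proof.
move=> nN; rewrite /term /= /bit insubT.
by rewrite -(tnth_nth 0 (sign_sequences x t) (Ordinal nN)) tnth_mktuple.
Qed.

Lemma sorted_le_last (r : seq nat) d : sorted ltn r -> d \in r -> (d <= last 0 r)%N.
Proof.
move=> sr /(nthP 0%N)[i ir <-]; rewrite -nth_last.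
have r0 : (0 < size r)%N by apply: leq_ltn_trans ir.
apply: (sorted_leq_nth leq_trans leqnn 0%N); rewrite ?inE ?prednK//.
  by apply: sub_sorted sr => a b /ltnW.
by rewrite -ltnS prednK.
Qed.

(** An iteration over U can be done row by row. Stated for an arbitrary
    commutative operation because it serves both for the product of the signs
    and for the count of the positions. *)
Lemma big_blocks (W : Type) (idx : W) (op : Monoid.com_law idx) (l : nat)
    (ks : 'I_l -> nat) (s : 'I_l -> S) (D : forall i, (ks i).-tuple nat) U
    (phi : S -> nat -> W) :
  injective s -> (forall i, uniq (D i)) ->
  (forall i d, d \in D i -> (d < N)%N) ->
  (forall u : X, reflect (exists2 i, u.1 = s i & val u.2 \in D i) (u \in U)) ->
  \big[op/idx]_(u in U) phi u.1 u.2 =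
  \big[op/idx]_(i < l) \big[op/idx]_(j < ks i) phi (s i) (tnth (D i) j).
Proof.
move=> si Du DN Udef.
rewrite (eq_bigl (fun u : X => (u.1 \in s @: finset.setT) && ((u.1, u.2) \in U))); last first.
  move=> u; rewrite -surjective_pairing andb_idl// => /Udef[i -> _].
  exact: imset_f.
rewrite -(pair_big_dep (fun t => t \in s @: finset.setT) (fun t n => (t, n) \in U)
   (fun t (n : 'I_N) => phi t n))/= big_imset/=; last by move=> i j _ _ /si.
apply: congr_big => //[i|i _]; first by rewrite inE.
rewrite -(big_tuple _ _ (D i) xpredT (phi (s i)))/=.
rewrite (eq_bigl (fun n : 'I_N => val n \in D i)); last first.
  move=> n; apply/Udef/idP => [[j /= /si <-//]|nD]; by exists i.
rewrite -(big_mkord (fun n => n \in D i) (phi (s i))) /index_iota subn0 -big_filter.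
apply: perm_big; apply: uniq_perm => [||d]; rewrite ?filter_uniq ?iota_uniq//.
rewrite mem_filter mem_iota/= add0n.
by have [/DN ->|] := boolP (d \in D i).
Qed.

Lemma cross_sum_blocks (l : nat) (ks : 'I_l -> nat) (s : 'I_l -> S)
    (D : forall i, (ks i).-tuple nat) U M x :
  injective s -> (forall i, uniq (D i)) ->
  (forall i d, d \in D i -> (d + M <= N)%N) -> (0 < M)%N ->
  (forall u : X, reflect (exists2 i, u.1 = s i & val u.2 \in D i) (u \in U)) ->
  cross_sum (sign_sequences x \o s) M D = correlation R U M x.
Proof.
move=> si Du DN M0 Udef.
rewrite /cross_sum /correlation big_add1/=; apply: eq_big_nat => n nM.
rewrite /shift_parity (big_morph (fun b : bool => (-1) ^+ b : R) (@signr_addb _) (erefl _)).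
rewrite (@big_blocks _ _ _ _ _ s D U (fun t d => (-1) ^+ bit x t (d + n)))//; last first.
  by move=> i d /DN; lia.
apply: eq_bigr => i _; apply: eq_bigr => j _ /=.
have := DN i _ (mem_tnth j (D i)); set d := tnth _ _ => dN.
rewrite addSn term_sign_sequences; first by rewrite addnC.
by case/andP: nM => _ nM; lia.
Qed.

(** From blocks to a set: collect all positions. From a set to blocks: the rows
    that the set meets, in any order, each with its increasing list of
    columns. *)
Lemma cross_values_correlation k x (v : R) : (0 < k)%N ->
  cross_values (sign_sequences x) k v <->
  exists M U, [/\ #|U| = k, (0 < M)%N, fits U M & v = `|correlation R U M x| ].
Proof.
move=> k0; split.
  move=> [l [ks [s [M [D [[l0 ks0 sk] si M0 adm ->]]]]]].
  pose U := [set u : X | [exists i, (u.1 == s i) && (val u.2 \in D i)]]%SET.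
  have Udef u : reflect (exists2 i, u.1 = s i & val u.2 \in D i) (u \in U).
    rewrite inE; apply: (iffP existsP) => [[i /andP[/eqP]]|[i -> h]]; exists i => //.
    by rewrite eqxx.
  have DN i d : d \in D i -> (d + M <= N)%N.
    move=> dD; have [sD _] := adm i; apply: leq_trans.
    by rewrite addnC leq_add2l sorted_le_last.
  have Du i : uniq (D i).
    by have [sD _ _] := adm i; exact: sorted_uniq ltn_trans ltnn _ sD.
  exists M, U; split=> //; last by rewrite (cross_sum_blocks _ si Du DN M0 Udef).
  - rewrite -sum1_card (@big_blocks _ _ _ _ _ s D U (fun _ _ => 1%N))//.
      by rewrite -sk; apply: eq_bigr => i _; rewrite sum_nat_const card_ord muln1.
    by move=> i d /DN; lia.
  - by move=> u /Udef[i _ /DN].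
move=> [M [U [Uk M0 fU ->]]].
pose T := [set u.1 | u in U]%SET.
pose s (i : 'I_#|T|) : S := enum_val i.
pose row t := [set n : 'I_N | (t, n) \in U]%SET.
pose D i := [tuple of map val (enum_tuple (row (s i)))].
have Drow t (n : 'I_N) : (val n \in map val (enum (row t))) = ((t, n) \in U).
  by rewrite (mem_map val_inj) mem_enum inE.
have DN i d : d \in D i -> (d + M <= N)%N.
  by move=> /mapP[n nD ->]; move: nD; rewrite mem_enum inE => /fU.
have Ds i : sorted ltn (D i).
  rewrite /= /enum_mem -enumT sorted_map.
  apply: sorted_filter; first by move=> ? ? ? /=; exact: ltn_trans.
  by rewrite -sorted_map val_enum_ord iota_ltn_sorted.
have Du i : uniq (D i) by exact: sorted_uniq ltn_trans ltnn _ (Ds i).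
have si : injective s by exact: enum_val_inj.
have Udef u : reflect (exists2 i, u.1 = s i & val u.2 \in D i) (u \in U).
  case: u => t n; apply: (iffP idP) => [tU|[i /= -> ]]; last by rewrite Drow.
  have tT : t \in T by apply/imsetP; exists (t, n).
  have e : s (enum_rank_in tT t) = t by rewrite /s enum_rankK_in.
  exists (enum_rank_in tT t); first by rewrite e.
  by have := Drow (s (enum_rank_in tT t)) n; rewrite [in RHS]e tU.
have Dgt i : (0 < #|row (s i)|)%N.
  have /imsetP[[t n] tU /= e] := enum_valP i.
  by apply/card_gt0P; exists n; rewrite inE /s e.
exists #|T|, (fun i => #|row (s i)|), s, M, D; split => //.
- split => //.
    apply/card_gt0P; move: Uk => /esym Uk; move: k0; rewrite Uk => /card_gt0P[u uU].
    by exists u.1; apply: imset_f.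
  rewrite -Uk -[in RHS]sum1_card [RHS](@big_blocks _ _ _ _ _ s D U (fun _ _ => 1%N))//.
    by apply: eq_bigr => i _; rewrite sum_nat_const card_ord muln1.
  by move=> i d /DN; lia.
- move=> i; split => //; first by rewrite -[ltnLHS]add0n ltn_add2r.
  rewrite addnC; apply: (DN i).
  have last_in (r : seq nat) : (0 < size r)%N -> last 0%N r \in r.
    by case: r => //= a r _; exact: mem_last.
  by apply: last_in; rewrite size_tuple.
- by rewrite (cross_sum_blocks _ si Du DN M0 Udef).
Qed.

Lemma tnth_sign_sequences x t n :
  tnth (sign_sequences x t) n = 1 \/ tnth (sign_sequences x t) n = -1.
Proof. by rewrite tnth_mktuple; case: (x _); [right|left]. Qed.

End CrossValues.

(** * Bounds on the logarithm of the number of labelled position sets *)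

Section Entropy.
Variables (R : realType) (A N k : nat).
Hypotheses (A2 : (2 <= A)%N) (k2 : (2 <= k)%N) (kN : (6 * k <= N)%N).

(** The logarithm of the number of ways to choose k columns and to label each of
    them with one of A sequences. *)
Definition entropy : R := ln ('C(N, k)%:R) + k%:R * ln (A%:R).

Local Notation lnN := (ln (N%:R : R)).
Local Notation lnA := (ln (A%:R : R)).
Local Notation lnk := (ln (k%:R : R)).

Let A0 : (0 < A)%N. Proof. lia. Qed.
Let k0 : (0 < k)%N. Proof. lia. Qed.
Let N0 : (0 < N)%N. Proof. lia. Qed.
Let kleN : (k <= N)%N. Proof. lia. Qed.
Let kR : 2 <= k%:R :> R. Proof. by rewrite (ler_nat R 2). Qed.
Let kNR : 6 * k%:R <= N%:R :> R. Proof. by rewrite -natrM ler_nat. Qed.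

Let lnNk : ln (N%:R / k%:R) = lnN - lnk.
Proof. by rewrite ln_div// posrE ltr0n. Qed.

Lemma lnA_ge : ln 2 <= lnA.
Proof. by rewrite ler_ln ?posrE ?ltr0n// ler_nat. Qed.

Lemma ln2_gt0 : 0 < ln (2 : R).
Proof. by apply: ln_gt0; rewrite (ltr_nat R 1 2). Qed.

Lemma lnA_ge0 : 0 <= lnA.
Proof. exact: le_trans (ltW ln2_gt0) lnA_ge. Qed.

Lemma entropy_ge : k%:R * (lnN + lnA - lnk) <= entropy.
Proof. by have := ln_bin_ge R k0 kleN; rewrite lnNk /entropy; lra. Qed.

Lemma entropy_le : entropy <= k%:R * (1 + (lnN + lnA - lnk)).
Proof. by have := ln_bin_le R k0 kleN; rewrite lnNk /entropy; lra. Qed.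

(** The quotient A N / k is at least 12, as A >= 2 and N >= 6 k. *)
Lemma log_density_ge : 23 / 10 <= lnN + lnA - lnk.
Proof.
apply: le_trans (ln12_ge R) _.
have h6 : ln (6 : R) <= lnN - lnk.
  by rewrite -lnNk ler_ln ?posrE ?divr_gt0 ?ltr0n// ler_pdivlMr// ltr0n.
have h12 : ln (12 : R) = ln 6 + ln 2.
  by rewrite -lnM ?posrE//; congr ln; lra.
by have := lnA_ge; lra.
Qed.

Lemma entropy_le_crude : entropy <= k%:R * (lnN + lnA).
Proof.
suff : ln ('C(N, k)%:R) <= k%:R * lnN by rewrite /entropy; lra.
rewrite mulr_natl -lnXn ?ltr0n// ler_ln ?posrE ?exprn_gt0 ?ltr0n ?bin_gt0//.
rewrite -natrX ler_nat; apply: leq_trans (bin_fact_leq N k).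
by rewrite leq_pmulr// fact_gt0.
Qed.

Lemma entropy_ge_bin j : (0 < j)%N -> (j <= k)%N ->
  j%:R * (lnN - ln j%:R) + k%:R * lnA <= entropy.
Proof.
move=> j0 jk.
have jN : (j <= N)%N by lia.
have h := ln_bin_ge R j0 jN.
rewrite ln_div ?posrE ?ltr0n// in h.
rewrite /entropy lerD2r; apply: le_trans h _.
by rewrite ler_ln ?posrE ?ltr0n ?bin_gt0// ler_nat leq_bin2r//; lia.
Qed.

Lemma entropy_ge2 : 2 * lnN <= entropy.
Proof.
have h := entropy_ge_bin (j := 2) isT k2.
have h2 : 2 * ln 2 <= k%:R * lnA.
  by apply: ler_pM => //; [exact: ltW ln2_gt0|exact: lnA_ge].
lra.
Qed.

Lemma entropy_ge0 : 0 <= entropy.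
Proof.
by apply: le_trans entropy_ge2; rewrite mulr_ge0// ln_ge0// ler1n.
Qed.

(** The hypothesis is k <= N / (6 log2 A), without the quotients. The bound
    makes (2/5) sqrt (N L) at most 0.32 N, well inside the range of a sum of
    about N / 2 signs. *)
Lemma entropy_le_linear : 6 * (k%:R * lnA) <= N%:R * ln 2 -> entropy <= 5 / 8 * N%:R.
Proof.
move=> kA; have h := ln_bin_le R k0 kleN; rewrite lnNk in h.
have k6 : 0 < 6 * k%:R :> R by rewrite mulr_gt0// ltr0n.
have e : lnN - lnk = ln 6 + ln (N%:R / (6 * k%:R)).
  by rewrite -lnM ?posrE ?divr_gt0 ?ltr0n// -lnNk; congr ln; field; rewrite gt_eqF ?ltr0n.
(* Splitting off ln 6 makes ln x <= x - 1 sharp at the extreme k = N / 6. *)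
have h1 : ln (N%:R / (6 * k%:R)) <= N%:R / (6 * k%:R) - 1 :> R.
  have := @le_ln1Dx R (N%:R / (6 * k%:R) - 1).
  rewrite addrCA subrr addr0; apply.
  by rewrite ltrBrDr addNr divr_gt0// ltr0n.
have h2 : k%:R * (lnN - lnk) <= k%:R * (2 + (N%:R / (6 * k%:R) - 1)).
  by rewrite ler_wpM2l// e lerD// ln6_le.
have h3 : k%:R * (2 + (N%:R / (6 * k%:R) - 1)) = k%:R + N%:R / 6 :> R.
  by field; rewrite gt_eqF ?ltr0n.
have h4 := ler_wpM2l (ler0n R N) (ln2_le R).
have h5 := kNR; rewrite h3 in h2; rewrite mulrDr mulr1 in h; rewrite /entropy.
move: (ler0n R N) h h2 h4 h5 kA.
move: (k%:R * (lnN - lnk)) (N%:R * ln 2) (k%:R * lnA) (ln 'C(N, k)%:R) => a b c d.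
lra.
Qed.

(** With y = A N / k, the number of position sets is at most (e y)^k, while the
    entropy is at least k ln y >= k. *)
Lemma ln_bin_le_double : ln ('C(A * N, k)%:R) <= 2 * entropy.
Proof.
have h := @ln_bin_le R (A * N) k k0 ltac:(nia).
have e : ln ((A * N)%:R / k%:R) = lnN + lnA - lnk.
  by rewrite natrM ln_div ?posrE ?mulr_gt0 ?ltr0n// lnM ?posrE ?ltr0n//; lra.
rewrite e in h; have h1 := entropy_ge; have h2 := log_density_ge.
have h3 : k%:R * 1 <= k%:R * (lnN + lnA - lnk) by rewrite ler_wpM2l//; lra.
lra.
Qed.

End Entropy.

(** * Lower bound for the tail of a sum of signs *)

Section LargeDeviation.
Variables (R : realType) (A N k : nat).
Hypotheses (A2 : (2 <= A)%N) (k2 : (2 <= k)%N) (kN : (6 * k <= N)%N).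
Hypotheses (N1000 : (1000 <= N)%N)
  (kA : 6 * (k%:R * ln (A%:R : R)) <= N%:R * ln 2).
Local Notation L := (entropy R A N k).
Local Notation lnN := (ln (N%:R : R)).
Local Notation m := (N %/ 4)%N.

Let N_le_4m : (N <= 4 * m + 3)%N. Proof. by clear -N; lia. Qed.
Let m_gt0 : (0 < m)%N. Proof. by clear -N1000; lia. Qed.
Let m4_le : (4 * m <= N)%N. Proof. by clear -N; lia. Qed.
Let N_gt0 : (0 < N)%N. Proof. by clear -N1000; lia. Qed.

(** The probability is bounded below by a single binomial term. The sum equals
    2 t when m + t of the 2 m signs are positive, so t is the least integer
    with 2 t > lam. With m about N / 4 the exponent (13/10) t^2 / m is
    about (13/10) (4/25) L = 0.208 L; the rounding of t and m and the linear
    term in t are absorbed by 0.21 and the constant 4, and the central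
    coefficient contributes at least 1 / sqrt N. *)
Lemma signed_sum_tail_ge :
  expR (- (21 / 100 * L + lnN / 2 + 4)) <=
  avg m.*2 (fun s => (2 / 5 * Num.sqrt (N%:R * L) < signed_sum R s)%R%:R).
Proof.
set lam := _ * Num.sqrt _.
have L0 : 0 <= L by exact: entropy_ge0.
have NR : 1000 <= N%:R :> R by rewrite (ler_nat R 1000).
have NL0 : 0 <= N%:R * L by rewrite mulr_ge0.
have lam0 : 0 <= lam by rewrite mulr_ge0// sqrtr_ge0.
have lam2 : lam ^+ 2 = 4 / 25 * (N%:R * L) by rewrite exprMn sqr_sqrtr//; lra.
have L58 : L <= 5 / 8 * N%:R by exact: entropy_le_linear.
have lam_le : lam <= 8 / 25 * N%:R.
  rewrite -(@ler_pXn2r _ 2) ?nnegrE ?mulr_ge0// lam2.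
  by have := ler_wpM2l (ler0n R N) L58; have : 0 <= N%:R * N%:R :> R; [exact: mulr_ge0|lra].
have mR : 249 / 1000 * N%:R <= m%:R :> R.
  by move: N_le_4m; rewrite -(ler_nat R) natrD natrM; lra.
have m0 := m_gt0.
have m0R : 0 < m%:R :> R by rewrite ltr0n.
pose t := (Num.truncn (lam / 2)).+1.
have /andP[tr1 tr2] : (Num.truncn (lam / 2))%:R <= lam / 2 < t%:R.
  by apply: truncn_itv; rewrite divr_ge0.
have t1 : t%:R <= lam / 2 + 1 by rewrite /t -natr1 lerD2r.
have tm : t%:R <= 13 / 20 * m%:R :> R by lra.
apply: (@le_trans _ _ ('C(m.*2, m + t)%:R / 2 ^+ m.*2)); last first.
  rewrite -avg_count; apply: avg_le => s sm.
  case: eqP => // e; rewrite signed_sum_count e sm.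
  suff -> : (lam < 2 * (m + t)%:R - m.*2%:R) by [].
  by rewrite -mul2n natrM natrD; lra.
have h := off_central_bin_ge m0 tm.
have c : expR (- (lnN / 2)) <= 'C(m.*2, m)%:R / 2 ^+ m.*2.
  rewrite -(@ler_pXn2r _ 2) ?nnegrE ?expR_ge0 ?divr_ge0 ?exprn_ge0//.
  rewrite -expRM_natl.
  have -> : 2%:R * - (lnN / 2) = - lnN by field.
  rewrite expRN lnK ?posrE ?ltr0n//.
  rewrite expr_div_n -exprM muln2 -!mul2n mulnA.
  rewrite exprM (_ : 2 ^+ 4 = 16 :> R); last by rewrite !exprS expr0; lra.
  rewrite ler_pdivlMr ?exprn_gt0// mulrC ler_pdivrMr ?ltr0n//.
  rewrite mul2n -!natrX -natrM ler_nat mulnC.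
  apply: leq_trans (central_bin_leq m0) _.
  by rewrite leq_mul2r m4_le orbT.
apply: (@le_trans _ _ (expR (- (lnN / 2)) * expR (- (13 / 10 * (t%:R * (t%:R + 1)) / m%:R)))).
  rewrite -expRD ler_expR.
  suff : 13 / 10 * (t%:R * (t%:R + 1)) / m%:R <= 21 / 100 * L + 4 by lra.
  rewrite ler_pdivrMr//.
  have tt : t%:R * (t%:R + 1) <= (lam / 2 + 1) * (lam / 2 + 2).
    by apply: ler_pM => //; lra.
  have e1 : (lam / 2 + 1) * (lam / 2 + 2) = lam ^+ 2 / 4 + 3 / 2 * lam + 2 by field.
  rewrite e1 lam2 in tt.
  have c0 : 0 <= 21 / 100 * L + 4 by lra.
  have := ler_wpM2l c0 mR.
  by rewrite (_ : _ * (_ * _) = 249 / 1000 * (21 / 100 * (N%:R * L) + 4 * N%:R));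
    [lra|ring].
apply: le_trans (ler_wpM2r (expR_ge0 _) c) _.
by rewrite mulrAC ler_pM2r ?invr_gt0 ?exprn_gt0.
Qed.

End LargeDeviation.

(** * Failure probabilities for a fixed order *)

Section Failures.
Variables (R : realType) (S : finType) (N k : nat).
Local Notation X := (S * 'I_N)%type.
Local Notation Omega := {ffun X -> bool}.
Hypotheses (S2 : (2 <= #|S|)%N) (k2 : (2 <= k)%N) (kN : (6 * k <= N)%N).
Implicit Types (x : Omega) (U V : {set X}).

Local Notation L := (entropy R #|S| N k).
Local Notation lnN := (ln (N%:R : R)).

Let N0 : (0 < N)%N. Proof. lia. Qed.
Let NR : 0 < N%:R :> R. Proof. by rewrite ltr0n. Qed.
Let L0 : 0 <= L. Proof. exact: entropy_ge0. Qed.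

Definition some_correlation_ge (b : R) x : bool :=
  [exists MU : 'I_N * {set X},
    ((#|MU.2| == k) && [forall u in MU.2, (val u.2 + MU.1.+1 <= N)%N]) &&
    (b <= `|correlation R MU.2 MU.1.+1 x|)].

(** The union bound over all M and U. *)
Lemma prob_some_correlation_ge :
  prob R (some_correlation_ge (5 / 2 * Num.sqrt (N%:R * L))) <=
  2 * expR (- (5 / 4 * lnN)).
Proof.
apply: le_trans (prob_exists_le _ _ _) _.
set b := _ * Num.sqrt _.
have b0 : 0 <= b by rewrite mulr_ge0// ?sqrtr_ge0//; lra.
have b2 : b ^+ 2 = 25 / 4 * (N%:R * L).
  by rewrite exprMn sqr_sqrtr ?mulr_ge0//; lra.
apply: (@le_trans _ _ (\sum_(MU : 'I_N * {set X} | #|MU.2| == k) 2 * expR (- (25 / 8 * L)))).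
  apply: (@le_trans _ _ (\sum_(MU : 'I_N * {set X} | (#|MU.2| == k) &&
      [forall u in MU.2, (val u.2 + MU.1.+1 <= N)%N]) 2 * expR (- (25 / 8 * L)))).
    apply: ler_sum => -[M U] /= /andP[/eqP Uk /'forall_implyP fU].
    have U0 : U != finset.set0 by rewrite -card_gt0 Uk; lia.
    apply: le_trans (correlation_tail U0 (M := M.+1) _ _ b0) _ => //.
    rewrite ler_pM2l// ler_expR lerN2 b2 ler_pdivlMr ?mulr_gt0 ?ltr0n//.
    have MN : (M.+1)%:R <= N%:R :> R by rewrite ler_nat.
    by have := ler_wpM2l L0 MN; lra.
  by rewrite big_mkcondr; apply: ler_sum => MU _; case: ifP => // _.
rewrite -(pair_big_dep xpredT (fun _ (U : {set X}) => #|U| == k)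
  (fun _ _ => 2 * expR (- (25 / 8 * L))))/=.
rewrite sumr_const card_ord -[_ *+ N]mulr_natl.
have -> : \sum_(U : {set X} | #|U| == k) 2 * expR (- (25 / 8 * L)) =
    'C(#|S| * N, k)%:R * (2 * expR (- (25 / 8 * L))).
  have -> : (#|S| * N = #|{: X}|)%N by rewrite card_prod card_ord.
  by rewrite -card_draws [RHS]mulr_natl -sumr_const; apply: eq_bigl => U; rewrite inE.
have kAN : (k <= #|S| * N)%N by nia.
have C0 : 0 < 'C(#|S| * N, k)%:R :> R by rewrite ltr0n bin_gt0.
rewrite -[N%:R]lnK ?posrE// -['C(_, _)%:R]lnK ?posrE//.
rewrite [_ * (2 * _)]mulrCA [expR _ * (2 * _)]mulrCA -!expRD lnK ?posrE// ler_pM2l// ler_expR.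
have := ln_bin_le_double R S2 k2 kN; have := entropy_ge2 R S2 k2 kN; lra.
Qed.

Section LowerTail.
Hypotheses (N1000 : (1000 <= N)%N)
  (kA : 6 * (k%:R * ln (#|S|%:R : R)) <= N%:R * ln 2).
Variable u0 : X.
Hypothesis u0_start : u0.2 = 0%N :> nat.
Local Notation M := (N %/ 4).*2.

Let M_le_N : (M <= N)%N. Proof. by clear; lia. Qed.
Let N_le_2NM : (N <= 2 * (N - M))%N. Proof. by clear; lia. Qed.

(** The positions that may accompany the anchor u0. Avoiding the row of u0 is
    what makes different sets of the family independent; the column bound
    leaves room for M shifts. *)
Definition free_positions : {set X} :=
  [set u : X | (u.1 \in ~: [set u0.1]) && (u.2 \in [set n : 'I_N | (n + M <= N)%N]%SET)]%SET.

Definition anchored_family : {set {set X}} :=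
  [set u0 |: U | U in
     [set U : {set X} | (U \subset free_positions) && (#|U| == k.-1)]]%SET.

Lemma anchor_notin U : U \subset free_positions -> u0 \notin U.
Proof.
move=> /fintype.subsetP sU; apply/negP => /sU.
by rewrite !inE eqxx.
Qed.

(** At least half of the rows and half of the columns remain. *)
Lemma card_free_positions : (#|S| * N <= 4 * #|free_positions|)%N.
Proof.
have -> : free_positions = finset.setX (~: [set u0.1])%SET [set n : 'I_N | (n + M <= N)%N]%SET.
  by apply/setP => u; rewrite !inE.
rewrite cardsX cardsC1.
have MN : (N - M <= N)%N by rewrite leq_subr.
have h : (N - M <= #|[set n : 'I_N | (n + M <= N)%N]%SET|)%N.
  have winj : injective (widen_ord MN) by move=> i j /(congr1 val)/= /val_inj.
  rewrite -[leqLHS]card_ord -(card_imset predT winj).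
  apply: subset_leq_card; apply/fintype.subsetP => n /imsetP[i _ ->].
  rewrite inE /=; have := ltn_ord i; move: (nat_of_ord i) M_le_N => j; clear; lia.
have h2 := N_le_2NM.
move: #|[set n : 'I_N | _]%SET| h => c h.
move: (#|S|) S2 h2 h; clear; nia.
Qed.

Lemma card_anchored_family : #|anchored_family| = 'C(#|free_positions|, k.-1).
Proof.
rewrite card_in_imset ?cards_draws// => U V.
rewrite !inE => /andP[/anchor_notin nU _] /andP[/anchor_notin nV _] e.
by rewrite -(setU1K nU) e setU1K.
Qed.

Lemma anchored_familyP U : U \in anchored_family ->
  [/\ #|U| = k, u0 \in U, forall u, u \in U -> u.1 = u0.1 -> u = u0
    & fits U M].
Proof.
move=> /imsetP[V]; rewrite inE => /andP[sV /eqP Vk] ->.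
have nV := anchor_notin sV; split.
- by rewrite cardsU1 nV Vk add1n prednK//; exact: ltnW k2.
- exact: setU11.
- move=> u; rewrite in_setU1 => /orP[/eqP //|uV] ut.
  by have := fintype.subsetP sV u uV; rewrite !inE ut eqxx.
- move=> u; rewrite in_setU1 => /orP[/eqP ->|uV]; first by rewrite u0_start.
  by have := fintype.subsetP sV u uV; rewrite !inE => /andP[].
Qed.

Definition no_anchored_correlation_gt (b : R) x : bool :=
  [forall U in anchored_family, ~~ (b < correlation R U M x)%R].

(** Chebyshev's inequality for the family: its sets have pairwise independent
    correlations, each distributed as a sum of M independent signs. *)
Lemma prob_no_anchored_le :
  prob R (no_anchored_correlation_gt (2 / 5 * Num.sqrt (N%:R * L))) <=
  expR (21 / 100 * L + lnN / 2 + 4 - ln ('C(#|free_positions|, k.-1)%:R)).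
Proof.
set b := _ * Num.sqrt _.
pose F (s : seq bool) : R := (b < signed_sum R s)%R%:R.
pose p := avg M F.
have p_ge : expR (- (21 / 100 * L + lnN / 2 + 4)) <= p.
  exact: signed_sum_tail_ge.
have p0 : 0 < p by apply: lt_le_trans p_ge; exact: expR_gt0.
have D0 : (0 < #|anchored_family|)%N.
  rewrite card_anchored_family bin_gt0; move: card_free_positions S2 k2 kN.
  by move: (#|S|) (#|free_positions|) => A W; clear; nia.
apply: le_trans (@second_moment R _ (card_Omega_gt0 S N) _ anchored_family
  (fun U x => (b < correlation R U M x)%R) p p0 D0 _ _) _.
- move=> U /anchored_familyP[Uk uU _ fU].
  have U0 : U != finset.set0 by apply/set0Pn; exists u0.
  rewrite /p -(mean_shifts F U0 fU); apply: eq_mean => x.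
  by rewrite correlationE.
- move=> U V /anchored_familyP[Uk uU unU fU] /anchored_familyP[Vk uV unV fV] UV.
  rewrite expr2 /p -(mean_shifts_pair F F uU uV erefl unU unV fU fV UV).
  by apply: eq_mean => x; rewrite !correlationE.
rewrite -card_anchored_family.
have DR : 0 < #|anchored_family|%:R :> R by rewrite ltr0n.
rewrite expRB lnK ?posrE// invfM mulrC ler_pM2r ?invr_gt0//.
rewrite -[expR _]invrK -expRN lef_pV2 ?posrE ?expR_gt0//.
Qed.

End LowerTail.
End Failures.

(** * Summation over the orders *)

Section Asymptotics.
Variables (R : realType) (S : finType) (N : nat).
Local Notation X := (S * 'I_N)%type.
Local Notation Omega := {ffun X -> bool}.
Hypotheses (S2 : (2 <= #|S|)%N) (N1000 : (1000 <= N)%N).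
Implicit Types (x : Omega) (k : nat).

Local Notation lnN := (ln (N%:R : R)).
Local Notation lnA := (ln (#|S|%:R : R)).
Local Notation L k := (entropy R #|S| N k).

Let N_gt0 : (0 < N)%N. Proof. by clear -N1000; lia. Qed.
Let A_gt0 : (0 < #|S|)%N. Proof. exact: ltnW. Qed.
Let lnN_ge0 : 0 <= lnN. Proof. by rewrite ln_ge0// ler1n. Qed.
Let lnA0 : 0 <= lnA. Proof. exact: lnA_ge0. Qed.

(** A common scale for all failure probabilities. Only the power N^(-0.08)
    matters; it comes from k = 2, where the lower bound for the expected
    number of large correlations is weakest. The constant 20000
    generously dominates those produced by ln k <= 100 for k <= 100. *)
Definition failure_rate : R := expR (20000 - 8 / 100 * lnN).

Lemma failure_rate_divN : failure_rate / N%:R = expR (20000 - 108 / 100 * lnN).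
Proof.
rewrite /failure_rate -{2}[N%:R]lnK ?posrE ?ltr0n// -expRB; congr expR; lra.
Qed.

Section FixedOrder.
Variable k : nat.
Hypotheses (k2 : (2 <= k)%N) (kN : (6 * k <= N)%N).

Let kR : 2 <= k%:R :> R. Proof. by rewrite (ler_nat R 2). Qed.
Let k_gt0 : (0 < k)%N. Proof. exact: ltnW. Qed.
Let predkR : k.-1%:R = k%:R - 1 :> R.
Proof. by rewrite -[in RHS](prednK k_gt0) -natr1 addrK. Qed.

Lemma ln_bin_free_ge W : (#|S| * N <= 4 * W)%N ->
  (k%:R - 1) * (lnN + lnA - ln k%:R - 7 / 5) <= ln ('C(W, k.-1)%:R : R).
Proof.
move=> hW.
have kW : (k.-1 <= W)%N.
  by move: S2 kN hW; move: (#|S|) => A; clear; nia.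
have k10 : (0 < k.-1)%N by rewrite -ltnS prednK.
apply: le_trans (ln_bin_ge R k10 kW).
rewrite predkR.
have k1 : 0 <= k%:R - 1 :> R by have := kR; lra.
apply: (ler_wpM2l k1).
have W0 : (0 < W)%N by apply: leq_trans kW.
have hWR : N%:R * #|S|%:R <= 4 * W%:R :> R by rewrite -!natrM ler_nat mulnC.
have h1 : lnN + lnA <= ln 4 + ln W%:R.
  rewrite -!lnM ?posrE ?ltr0n// ler_ln ?posrE ?mulr_gt0 ?ltr0n//.
have h2 : ln (4 : R) <= 7 / 5.
  have -> : (4 : R) = 2 * 2 by lra.
  by rewrite lnM ?posrE//; have := ln2_le R; lra.
have h3 : ln (k%:R - 1 : R) <= ln k%:R.
  by rewrite -predkR ler_ln ?posrE ?ltr0n// ler_nat leq_pred.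
rewrite ln_div ?posrE ?ltr0n//; last by rewrite -predkR ltr0n.
lra.
Qed.

(** Up to a constant, ln (binom W (k - 1)) is at least (k - 1) (ln N + ln |S|),
    and the entropy is at most k (ln N + ln |S|). The gain
    k - 1 - 0.21 k - 1/2 is smallest at k = 2, where it is 0.08. *)
Lemma lower_exponent_small W : (#|S| * N <= 4 * W)%N -> (k <= 100)%N ->
  21 / 100 * L k + lnN / 2 + 4 - ln ('C(W, k.-1)%:R) <= 20000 - 8 / 100 * lnN.
Proof.
move=> /ln_bin_free_ge hW k100.
have kR' := kR; have lN := lnN_ge0; have lA := lnA0.
have k100R : k%:R <= 100 :> R by rewrite (ler_nat R _ 100).
have lk : ln (k%:R : R) <= 100.
  by apply: le_trans k100R; apply: ltW; apply: ln_sublinear; rewrite ltr0n.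
have hL := entropy_le_crude R S2 k2 kN.
have s0 : lnN <= lnN + lnA by rewrite lerDl.
have h1 : (k%:R - 1) * (ln k%:R + 7/5) <= 99 * (100 + 7/5) :> R.
  apply: ler_pM; try lra.
  by rewrite addr_ge0// ln_ge0// ler1n.
have h2 : 0 <= (k%:R - 2) * (lnN + lnA) by apply: mulr_ge0; [rewrite subr_ge0|exact: addr_ge0].
move: hW hL s0 h1 h2 lN; rewrite /=; move: (lnN + lnA) (ln (k%:R : R)) => s l.
lra.
Qed.

(** Here k - 1 >= 0.99 k, and ln (|S| N / k) >= 23/10 gives
    ln (binom W (k - 1)) >= L / 4. The surplus 0.04 L is at least
    4 (ln N - ln 100), more than what a sum over all k <= N costs. *)
Lemma lower_exponent_large W : (#|S| * N <= 4 * W)%N -> (100 < k)%N ->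
  21 / 100 * L k + lnN / 2 + 4 - ln ('C(W, k.-1)%:R) <= 20000 - 108 / 100 * lnN.
Proof.
move=> /ln_bin_free_ge hW k100.
have kR' := kR; have lN := lnN_ge0; have lA := lnA0.
have k100R : 100 <= k%:R :> R by rewrite (ler_nat R 100) ltnW.
have hL := entropy_le R S2 k2 kN.
have hY := log_density_ge R S2 k2 kN.
have hL2 := @entropy_ge_bin R #|S| N k S2 k2 kN 100 isT (ltnW k100).
have kA0 : 0 <= k%:R * lnA by rewrite mulr_ge0.
have l100 : ln (100%:R : R) <= 100 by apply: ltW; apply: ln_sublinear; rewrite ltr0n.
move: hL hY hW; move: (lnN + lnA - ln k%:R) => Y hL hY hW.
have h1 : 99 / 100 * k%:R * (Y - 7 / 5) <= (k%:R - 1) * (Y - 7 / 5).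
  by rewrite ler_wpM2r//; lra.
have h2 : k%:R * (1 / 4 * (1 + Y)) <= k%:R * (99 / 100 * (Y - 7 / 5)).
  by rewrite ler_wpM2l//; lra.
lra.
Qed.

Hypothesis kA : 6 * (k%:R * lnA) <= N%:R * ln 2.

Definition within_bounds x : bool :=
  `[< 2 / 5 * Num.sqrt (N%:R * L k) < cross_correlation (sign_sequences R x) k /\
      cross_correlation (sign_sequences R x) k < 5 / 2 * Num.sqrt (N%:R * L k) >].

Let M_gt0 : (0 < (N %/ 4).*2)%N.
Proof. by clear -N1000; lia. Qed.

Let kleN : (k <= N)%N. Proof. by clear -kN; lia. Qed.

Lemma not_within_bounds (u0 : X) x : u0.2 = 0%N :> nat -> ~~ within_bounds x ->
  no_anchored_correlation_gt k u0 (2 / 5 * Num.sqrt (N%:R * L k)) x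
  || some_correlation_ge k (5 / 2 * Num.sqrt (N%:R * L k)) x.
Proof.
move=> u00; apply: contraR; rewrite negb_or => /andP[hlow hup].
have [ccin ccub] := cross_correlation_max (k := k) (@tnth_sign_sequences R S N x) A_gt0
  ltac:(by rewrite k_gt0 kleN).
apply/asboolP; split.
  move: hlow; rewrite /no_anchored_correlation_gt negb_forall_in => /existsP[U /andP[UF]].
  rewrite negbK => /lt_le_trans; apply.
  apply: le_trans (ler_norm _) _; apply: ccub.
  have [Uk _ _ fU] := anchored_familyP k2 u00 UF.
  by apply/cross_values_correlation => //; exists (N %/ 4).*2, U.
have [M [U [Uk M0 fU e]]] := (cross_values_correlation x _ k_gt0).1 ccin.
rewrite e ltNge; apply: contra hup => hb.
have MN : (M.-1 < N)%N.
  have [u uU] : exists u, u \in U by apply/card_gt0P; rewrite Uk.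
  by rewrite prednK//; apply: leq_trans (fU u uU); rewrite leq_addl.
apply/existsP; exists (Ordinal MN, U); rewrite /= prednK// Uk eqxx hb andbT/=.
by apply/'forall_implyP.
Qed.

(** Only the first hundred orders cost a full rate; the cost of every other
    order is divided by N, so that N of them can be added up. *)
Lemma prob_not_within_bounds :
  prob R (fun x => ~~ within_bounds x) <=
  (k <= 100)%N%:R * failure_rate + 3 * (failure_rate / N%:R).
Proof.
have [t0 _] : exists t0 : S, t0 \in S by apply/card_gt0P.
pose u0 : X := (t0, Ordinal N_gt0).
have u00 : u0.2 = 0%N :> nat by [].
apply: (@le_trans _ _ (prob R (no_anchored_correlation_gt k u0 (2 / 5 * Num.sqrt (N%:R * L k)))
   + prob R (some_correlation_ge k (5 / 2 * Num.sqrt (N%:R * L k)) : pred Omega))).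
  rewrite /prob -meanD; apply: le_mean => x.
  have := not_within_bounds u00 (x := x).
  case: (within_bounds x) => /=; first by rewrite addr_ge0.
  by move=> /(_ isT) /orP[->|->]; rewrite ?lerDl ?lerDr.
have lN := lnN_ge0.
have hcard := card_free_positions S2 u0.
have hdelta : 0 <= failure_rate / N%:R by rewrite divr_ge0// expR_ge0.
have hup : prob R (some_correlation_ge k (5 / 2 * Num.sqrt (N%:R * L k)) : pred Omega)
    <= 2 * (failure_rate / N%:R).
  apply: le_trans (prob_some_correlation_ge R S2 k2 kN) _.
  by rewrite failure_rate_divN ler_pM2l// ler_expR; lra.
have hlow := prob_no_anchored_le S2 k2 kN N1000 kA u00.
have [k100|k100] := leqP k 100.
  have := le_trans hlow (_ : _ <= failure_rate).
  rewrite ler_expR => /(_ (lower_exponent_small hcard k100)) h.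
  by rewrite mul1r; lra.
have := le_trans hlow (_ : _ <= failure_rate / N%:R).
rewrite failure_rate_divN ler_expR => /(_ (lower_exponent_large hcard k100)) h.
by move: hup hdelta; rewrite failure_rate_divN mul0r; lra.
Qed.

End FixedOrder.
Definition admissible_order k : bool :=
  [&& (2 <= k)%N, (6 * k <= N)%N & 6 * (k%:R * lnA) <= N%:R * ln 2].

Lemma prob_some_order_fails :
  prob R (fun x => [exists k : 'I_N, admissible_order k && ~~ within_bounds k x])
    <= 104 * failure_rate.
Proof.
apply: le_trans (prob_exists_le _ _ _) _.
have d0 : 0 <= failure_rate by exact: expR_ge0.
apply: (@le_trans _ _ (\sum_(k < N) ((k <= 100)%N%:R * failure_rate +
    3 * (failure_rate / N%:R)))).
  rewrite big_mkcond; apply: ler_sum => k _; case: ifP => [/and3P[k2 kN kA]|_].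
    exact: prob_not_within_bounds.
  by rewrite addr_ge0 ?mulr_ge0// invr_ge0.
rewrite big_split/= -mulr_suml sumr_const card_ord -[_ *+ N]mulr_natl.
have -> : N%:R * (3 * (failure_rate / N%:R)) = 3 * failure_rate.
  by field; rewrite pnatr_eq0 -lt0n.
suff : \sum_(k < N) (k <= 100)%N%:R <= 101%:R :> R.
  by move=> h; have := ler_wpM2r d0 h; lra.
suff : forall n, \sum_(k < n) (k <= 100)%N%:R = (minn n 101)%:R :> R.
  by move->; rewrite ler_nat geq_minr.
elim=> [|n IH]; first by rewrite big_ord0.
rewrite big_ord_recr/= IH -natrD; congr _%:R.
by clear; case: leqP => h /=; lia.
Qed.

End Asymptotics.

Section FiniteModel.
Variable R : realType.

Lemma failure_rate_cvg (eps : R) : 0 < eps ->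
  exists2 N0 : nat, (1000 <= N0)%N &
    forall N, (N0 < N)%N -> 104 * failure_rate R N <= eps.
Proof.
move=> e0.
pose lam : R := 100 / 8 * (20000 + ln (104 / eps)).
exists (1000 + Num.truncn (expR lam))%N; first exact: leq_addr.
move=> N hN.
have N_gt0 : (0 < N)%N by apply: leq_ltn_trans hN.
have h : expR lam <= N%:R.
  apply: le_trans (ltW (truncnS_gt _)) _; rewrite ler_nat.
  by apply: leq_trans hN; rewrite ltnS leq_addl.
have h2 : lam <= ln (N%:R : R) by rewrite -ler_expR lnK ?posrE ?ltr0n.
have h3 : failure_rate R N <= expR (- ln (104 / eps)).
  by rewrite ler_expR; move: h2; rewrite /lam; lra.
rewrite expRN lnK ?posrE ?divr_gt0// in h3.
have := ler_wpM2l (ler0n R 104) h3.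
by rewrite invf_div mulrCA divff ?mulr1// pnatr_eq0.
Qed.

End FiniteModel.

(** * From random signs to uniform Boolean arrays *)

Section Transfer.
Variables (R : realType) (S : finType) (N : nat).
Variables (d : measure_display) (T : measurableType d) (P : probability T R).
Variable e : S -> 'I_N -> {RV P >-> R}.
Hypothesis signs_e : uniform_independent_signs P e.
Local Notation X := (S * 'I_N)%type.
Local Notation Omega := {ffun X -> bool}.

Definition sign_bits (w : T) : Omega := [ffun u : X => e u.1 u.2 w == -1].

Let one_eqN1 : (1 == -1 :> R) = false.
Proof. by apply/eqP => h; have : 0 < 1 :> R by []; rewrite h; lra. Qed.

Lemma generator_of_sign_bits w :
  generator_of e w = sign_sequences R (sign_bits w).
Proof.
have [pm _ _] := signs_e.
apply/funext => t; apply: eq_from_tnth => n; rewrite !tnth_mktuple ffunE/=.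
by have [->|->] := pm t n w; rewrite ?one_eqN1 ?eqxx.
Qed.

Let B (x : Omega) (u : X) : set R := [set (-1) ^+ x u].

Let sign_bits_atom x :
  [set w | sign_bits w = x] =
  \bigcap_(u in [set` [set: X]%SET]) ((e u.1 u.2 : T -> R) @^-1` B x u).
Proof.
have [pm _ _] := signs_e.
apply/seteqP; split => [w /= <- u _|w /= h].
  rewrite /B/= ffunE; have [->|->] := pm u.1 u.2 w; last by rewrite eqxx.
  by rewrite one_eqN1.
apply/ffunP => u; rewrite ffunE; have := h u; rewrite /= inE => /(_ isT) ->.
by case: (x u); rewrite ?eqxx// expr0 one_eqN1.
Qed.

Let measurable_sign_bits_atom x : measurable [set w | sign_bits w = x].
Proof.
rewrite sign_bits_atom; apply: fin_bigcap_measurable => // u _.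
rewrite -[X in measurable X]setTI; apply: measurable_funP => //.
exact: measurable_set1.
Qed.

(** Mutual independence, applied to the whole family with each sign prescribed. *)
Lemma sign_bits_uniform x :
  P [set w | sign_bits w = x] = ((#|{: Omega}|%:R)^-1)%:E.
Proof.
have [pm half indep] := signs_e.
have mB u : measurable (B x u) by exact: measurable_set1.
rewrite sign_bits_atom (indep [set: X]%SET (B x) mB).
rewrite (eq_bigr (fun=> (2^-1)%:E)); last first.
  move=> u _; rewrite /B; have [h1 h2] := half u.1 u.2.
  by case: (x u); [exact: h2|exact: h1].
rewrite prodEFin prodr_const cardsT card_ffun card_bool natrX exprVn.
by [].
Qed.

Lemma probability_sign_bits (A : pred Omega) :
  P [set w | A (sign_bits w)] = (prob R A)%:E.
Proof.
pose F x : set T := if A x then [set w | sign_bits w = x] else set0.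
have -> : [set w | A (sign_bits w)] = \bigcup_(x in [set: Omega]) F x.
  apply/seteqP; split => [w /= Aw|w [x _]].
    by exists (sign_bits w) => //; rewrite /F Aw.
  by rewrite /F; case: ifP => //= Ax ->.
rewrite measure_fin_bigcup//.
- rewrite (fsbigE (index_enum Omega)) ?index_enum_uniq//=; last first.
    by move=> x _; rewrite mem_index_enum.
  rewrite (eq_bigl xpredT); last by move=> x; rewrite in_setT.
  rewrite /prob /mean mulr_suml -sumEFin; apply: eq_bigr => x _.
  rewrite /F; case: (A x); rewrite ?measure0 ?mul0r//.
  by rewrite mul1r sign_bits_uniform.
- exact: finite_finset.
- move=> x y _ _ [w []]; rewrite /F.
  by case: (A x) => //; case: (A y) => //= -> .
- by move=> x _; rewrite /F; case: ifP => // _; exact: measurable_sign_bits_atom.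
Qed.

End Transfer.

(** * The two-sided bound *)

Section Log2.
Variable R : realType.

Lemma one_le_log2 (n : nat) : 1 <= log2 (n%:R : R) -> (2 <= n)%N.
Proof.
rewrite /log2 ler_pdivlMr ?ln2_gt0// mul1r => h.
have n0 : (0 < n)%N.
  by case: n h => //; rewrite (ln0 (lexx 0)) leNgt ln2_gt0.
by move: h; rewrite ler_ln ?posrE ?ltr0n// ler_nat.
Qed.

Lemma admissible_order_of_log2 (S : finType) (N k : nat) :
  1 <= log2 (#|S|%:R : R) -> (2 <= k)%N ->
  k%:R <= N%:R / (6 * log2 (#|S|%:R : R)) -> admissible_order R S N k.
Proof.
move=> S1 k2; have log_gt0 := lt_le_trans ltr01 S1.
have c0 : 0 < 6 * log2 (#|S|%:R : R) by exact: mulr_gt0.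
rewrite ler_pdivlMr// => h.
apply/and3P; split=> //.
  rewrite -(ler_nat R) natrM; apply: le_trans h; rewrite mulrC ler_wpM2l//.
  by lra.
have e : ln (#|S|%:R : R) = log2 #|S|%:R * ln 2.
  by rewrite /log2 divfK// gt_eqF// ln2_gt0.
by rewrite e; have := ler_wpM2r (ltW (ln2_gt0 R)) h; lra.
Qed.

End Log2.

Theorem theorem3 (R : realType) (eps : R) (eps_gt0 : 0 < eps) :
  exists N0 : nat,
    forall (N : nat), (N0 < N)%N ->
    forall (S : finType),
      1 <= log2 (#|S|%:R : R) -> log2 (#|S|%:R : R) < N%:R / 12 ->
    forall (d : measure_display) (T : measurableType d) (P : probability T R)
           (e : S -> 'I_N -> {RV P >-> R}),
      uniform_independent_signs P e ->
      ((1 - eps)%R%:E <=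
        P [set w : T | (forall k : nat,
             (2 <= k)%N -> k%:R <= N%:R / (6 * log2 (#|S|%:R : R)) ->
             2 / 5 * Num.sqrt (N%:R * (ln ('C(N, k)%:R)
                                       + k%:R * ln (#|S|%:R)))
               < cross_correlation (generator_of e w) k
             /\ cross_correlation (generator_of e w) k
               < 5 / 2 * Num.sqrt (N%:R * (ln ('C(N, k)%:R)
                                           + k%:R * ln (#|S|%:R))))%R])%E.
Proof.
have [N0 N0_ge rateN] := failure_rate_cvg eps_gt0.
exists N0 => N N0N S S1 _ d T P e signs_e.
have S2 := one_le_log2 S1.
have N1000 : (1000 <= N)%N by apply: leq_trans N0_ge (ltnW N0N).
pose order k := `[< (2 <= k)%N /\ k%:R <= N%:R / (6 * log2 (#|S|%:R : R)) >].
pose good (x : {ffun S * 'I_N -> bool}) :=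
  ~~ [exists k : 'I_N, order k && ~~ within_bounds R k x].
have -> : [set w : T | forall k : nat,
    (2 <= k)%N -> k%:R <= N%:R / (6 * log2 (#|S|%:R : R)) ->
    2 / 5 * Num.sqrt (N%:R * (ln ('C(N, k)%:R) + k%:R * ln (#|S|%:R)))
      < cross_correlation (generator_of e w) k
    /\ cross_correlation (generator_of e w) k
      < 5 / 2 * Num.sqrt (N%:R * (ln ('C(N, k)%:R) + k%:R * ln (#|S|%:R)))]
    = [set w | good (sign_bits e w)].
  apply/seteqP; split => w /=; rewrite (generator_of_sign_bits signs_e).
    move=> h; apply/existsP => -[k /andP[/asboolP[k2 kN] /negP]]; apply.
    exact/asboolP/h.
  move=> /existsPn h k k2 kN.
  have /and3P[_ kN6 _] := admissible_order_of_log2 S1 k2 kN.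
  have ltkN : (k < N)%N by clear -kN6 k2; lia.
  have := h (Ordinal ltkN); rewrite negb_and negbK => /orP[/asboolP[] //|].
  by move/asboolP.
rewrite (probability_sign_bits signs_e) lee_fin.
have hbad := prob_some_order_fails R S2 N1000.
have hge : 1 <= prob R good +
    prob R (fun x : {ffun S * 'I_N -> bool} =>
      [exists k : 'I_N, admissible_order R S N k && ~~ within_bounds R k x]).
  rewrite /prob -meanD -[leLHS](mean_cst (card_Omega_gt0 S N)).
  apply: le_mean => x; rewrite /good.
  case: existsP => [[k /andP[/asboolP[k2 kN] bad]]|_] /=; last by rewrite lerDl.
  have -> : [exists k : 'I_N, admissible_order R S N k && ~~ within_bounds R k x].
    by apply/existsP; exists k; rewrite bad andbT admissible_order_of_log2.
  by rewrite add0r.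
have := rateN N N0N; lra.
Qed.
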